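(* Let $\mathbb{F}$ be an arbitrary field. The coinvariant algebra $\mathbb{F}[\mathbf{x}]/(\mathbb{F}[\mathbf{x}]^{\mathfrak S_n}_+)$, with the $H_n(0)$-action $T_i\mapsto\overline\pi_i$, has an $\mathbb{F}$-basis $\{\overline\pi_w x_{D(w)} : w\in\mathfrak S_n\}$ and decomposes as \[ \mathbb{F}[\mathbf{x}]/(\mathbb{F}[\mathbf{x}]^{\mathfrak S_n}_+)=\bigoplus_{\alpha\models n} H_n(0)\cdot\overline\pi_{w_0(\alpha)}x_{D(\alpha)}, \] where for every composition $\alpha$ of $n$ the summand $H_n(0)\cdot\overline\pi_{w_0(\alpha)}x_{D(\alpha)}$ has $\mathbb{F}$-basis $\{\overline\pi_w x_{D(\alpha)}: w\in[w_0(\alpha),w_1(\alpha)]\}$ and is isomorphic to the projective indecomposable $H_n(0)$-module $\mathbf P_\alpha$. Consequently $\mathbb{F}[\mathbf{x}]/(\mathbb{F}[\mathbf{x}]^{\mathfrak S_n}_+)$ is isomorphic to the regular representation of $H_n(0)$.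
   Context: Let $n\ge1$, $\mathbb{F}[\mathbf{x}]=\mathbb{F}[x_1,\dots,x_n]$, with $\mathfrak S_n$ permuting the variables; $s_i=(i,i+1)$. $(\mathbb{F}[\mathbf{x}]^{\mathfrak S_n}_+)$ is the ideal generated by symmetric polynomials of positive degree. The $0$-Hecke algebra $H_n(0)$ is the $\mathbb{F}$-algebra generated by $T_1,\dots,T_{n-1}$ with relations $T_i^2=-T_i$, $T_iT_{i+1}T_i=T_{i+1}T_iT_{i+1}$, $T_iT_j=T_jT_i$ for $|i-j|>1$; put $T'_i=T_i+1$, and for a reduced word $w=s_{i_1}\cdots s_{i_k}$ set $T_w=T_{i_1}\cdots T_{i_k}$, $T'_w=T'_{i_1}\cdots T'_{i_k}$. The Demazure operators are $\pi_i f=\frac{x_if-x_{i+1}s_i(f)}{x_i-x_{i+1}}$, and $\overline\pi_i=\pi_i-1$; $H_n(0)$ acts on $\mathbb{F}[\mathbf{x}]$ by $T_i\mapsto\overline\pi_i$ (this preserves degree and the ideal above, hence acts on the coinvariant algebra), and $\overline\pi_w=\overline\pi_{i_1}\cdots\overline\pi_{i_k}$ for a reduced word. For $I\subseteq[n-1]$, $x_I=\prod_{i\in I}x_1x_2\cdots x_i$. $D(w)=\{i\in[n-1]:w(i)>w(i+1)\}$. A composition $\alpha=(\alpha_1,\dots,\alpha_\ell)\models n$ has $D(\alpha)=\{\alpha_1,\alpha_1+\alpha_2,\dots,\alpha_1+\dots+\alpha_{\ell-1}\}$; $\alpha^c$ is the composition with $D(\alpha^c)=[n-1]\setminus D(\alpha)$.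 $w_0(\alpha)$ is the longest element of the subgroup generated by $\{s_i:i\in D(\alpha)\}$ (so $w_0(\alpha^c)$ is the longest element of the subgroup generated by $\{s_i:i\notin D(\alpha)\}$). The set $\{w:D(w)=D(\alpha)\}$ is an interval $[w_0(\alpha),w_1(\alpha)]$ in the left weak order. $\mathbf P_\alpha:=H_n(0)\,T_{w_0(\alpha)}T'_{w_0(\alpha^c)}$ (a projective indecomposable left $H_n(0)$-module). *)

(* Defs.v *)
From HB Require Import structures.
From mathcomp Require Import all_boot all_order all_algebra all_fingroup.
From mathcomp Require Import monalg.
From mathcomp Require Import mpoly.
From Stdlib Require Import ClassicalEpsilon.

Set Implicit Arguments.
Unset Strict Implicit.
Unset Printing Implicit Defensive.

Import GRing.Theory.
Local Open Scope ring_scope.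

(* Conventions.  Variables x_1..x_n are 'X_k for k : 'I_n (0-based).   *)
(* The generator s_i (1 <= i <= n-1) is indexed by j : 'I_n.-1 with     *)
(* i = j+1; it swaps the (0-based) positions lo j = j and hi j = j+1.   *)
(* Subsets of [n-1] are {set 'I_n.-1} (j represents i = j+1).           *)

Section QuotientNotions.
Variable F : fieldType.

(* The classes of b i (i with P i) form an F-basis of S/W
   (S is a subspace of V containing the subspace W). *)
Definition qbasis (V : lmodType F) (W S : V -> Prop) (I : finType)
    (P : pred I) (b : I -> V) : Prop :=
  [/\ forall i, P i -> S (b i),
      forall c : I -> F, W (\sum_(i | P i) c i *: b i) -> forall i, P i -> c i = 0
    & forall x, S x -> exists c : I -> F, W (x - \sum_(i | P i) c i *: b i)].

(* V/W is the (internal) direct sum of the sub-quotients S k / W, k ranging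
   over the indices satisfying P. *)
Definition qdirect_sum (V : lmodType F) (W : V -> Prop) (Idx : eqType)
    (P : Idx -> bool) (S : Idx -> V -> Prop) : Prop :=
  (forall x, exists l : seq (Idx * V),
      (forall t, t \in l -> P t.1 /\ S t.1 t.2) /\ W (x - \sum_(t <- l) t.2))
  /\ (forall l : seq (Idx * V), uniq (map fst l) ->
      (forall t, t \in l -> P t.1 /\ S t.1 t.2) ->
      W (\sum_(t <- l) t.2) -> forall t, t \in l -> W t.2).

(* An isomorphism of H_n(0)-modules S1/W1 ~= S2/W2, where T1 j, T2 j
   are the actions of the generator T_{j+1} on representatives.  It is given
   by a map phi on representatives which induces a well defined, F-linear,
   bijective, H_n(0)-equivariant map of the quotients. *)
Definition qiso (m : nat) (V1 V2 : lmodType F)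
    (W1 S1 : V1 -> Prop) (T1 : 'I_m -> V1 -> V1)
    (W2 S2 : V2 -> Prop) (T2 : 'I_m -> V2 -> V2) : Prop :=
  exists phi : V1 -> V2,
  [/\ forall x, S1 x -> S2 (phi x),
      forall (c : F) x y, S1 x -> S1 y -> W2 (phi (c *: x + y) - (c *: phi x + phi y)),
      forall x, S1 x -> (W2 (phi x) <-> W1 x),
      forall y, S2 y -> exists2 x, S1 x & W2 (y - phi x)
    & forall j x, S1 x -> W2 (phi (T1 j x) - T2 j (phi x))].

End QuotientNotions.

Section Defs.
Variables (F : fieldType) (n : nat).

Lemma hi_proof (j : 'I_n.-1) : (j.+1 < n)%N.
Proof. by case: n j => [|m] [j hj]. Qed.

Definition lo (j : 'I_n.-1) : 'I_n := widen_ord (leq_pred n) j.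
Definition hi (j : 'I_n.-1) : 'I_n := Ordinal (hi_proof j).

Definition sgen (j : 'I_n.-1) : 'S_n := tperm (lo j) (hi j).

(* s_{i_1} s_{i_2} ... s_{i_k} (composition of maps, s_{i_k} applied first) *)
Definition word_perm (u : seq 'I_n.-1) : 'S_n :=
  foldr (fun j p => (p * sgen j)%g) 1%g u.

Definition perm_length (w : 'S_n) : nat :=
  #|[set p : 'I_n * 'I_n | (p.1 < p.2)%N && (w p.2 < w p.1)%N]|.

Definition reduced_word (u : seq 'I_n.-1) (w : 'S_n) : bool :=
  (word_perm u == w) && (size u == perm_length w).

Definition descents (w : 'S_n) : {set 'I_n.-1} :=
  [set j | (w (hi j) < w (lo j))%N].

Definition is_composition (alpha : seq nat) : bool :=
  all (fun a => 0 < a)%N alpha && (sumn alpha == n).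

Definition comp_descents (alpha : seq nat) : {set 'I_n.-1} :=
  [set j : 'I_n.-1 | j.+1 \in [seq sumn (take k alpha) | k <- iota 1 (size alpha).-1]].

Definition w0_of (D : {set 'I_n.-1}) : 'S_n :=
  [arg max_(w > 1%g in <<[set sgen j | j in D]>>%g) perm_length w].

Definition Poly := mpoly.mpoly n F.

Definition xD (D : {set 'I_n.-1}) : Poly :=
  \prod_(j in D) \prod_(k : 'I_n | (k <= j)%N) 'X_k.

(* Demazure operator pi_i f = (x_i f - x_{i+1} s_i(f)) / (x_i - x_{i+1})
   (the exact quotient in F[x]) *)
Definition demazure (j : 'I_n.-1) (f : Poly) : Poly :=
  epsilon (inhabits 0) (fun g : Poly =>
    ('X_(lo j) - 'X_(hi j)) * g = 'X_(lo j) * f - 'X_(hi j) * msym (sgen j) f).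

Definition demazure_bar (j : 'I_n.-1) (f : Poly) : Poly := demazure j f - f.

Definition pibar_word (u : seq 'I_n.-1) (f : Poly) : Poly :=
  foldr (fun j g => demazure_bar j g) f u.

Definition sym_plus (p : Poly) : bool :=
  (p \is symmetric) && (mpoly.mcoeff 0%MM p == 0).

Definition coinv_ideal (p : Poly) : Prop :=
  exists l : seq (Poly * Poly),
    (forall t, t \in l -> sym_plus t.2) /\ p = \sum_(t <- l) t.1 * t.2.

(* free associative F-algebra on T_1, ..., T_{n-1} *)
Definition FA := {malg F[{fmonom 'I_n.-1}]}.

Definition Tgen (j : 'I_n.-1) : FA := monalg.mkmalgU (fmu j) 1.
Definition Tword (u : seq 'I_n.-1) : FA := \prod_(j <- u) Tgen j.
Definition T'word (u : seq 'I_n.-1) : FA := \prod_(j <- u) (Tgen j + 1).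

Definition hecke_rel (a : FA) : Prop :=
  [\/ exists j, a = Tgen j * Tgen j + Tgen j,
      exists j k : 'I_n.-1, (k = j.+1 :> nat) /\
        a = Tgen j * Tgen k * Tgen j - Tgen k * Tgen j * Tgen k
    | exists j k : 'I_n.-1, ((j.+1 < k) || (k.+1 < j))%N /\
        a = Tgen j * Tgen k - Tgen k * Tgen j].

(* membership in the two-sided ideal of relations; H_n(0) = FA / hecke_ideal *)
Definition hecke_ideal (a : FA) : Prop :=
  exists l : seq (FA * FA * FA),
    (forall t, t \in l -> hecke_rel t.1.2) /\ a = \sum_(t <- l) t.1.1 * t.1.2 * t.2.

Definition hecke_lmul (j : 'I_n.-1) (a : FA) : FA := Tgen j * a.

Definition hecke_act (a : FA) (f : Poly) : Poly :=
  \sum_(u <- finmap.enum_fset (monalg.msupp a)) monalg.mcoeff u a *: pibar_word (fmonom_val u) f.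

Section WithReducedWords.
Variable rw : 'S_n -> seq 'I_n.-1.

Definition summand_gen (alpha : seq nat) : Poly :=
  pibar_word (rw (w0_of (comp_descents alpha))) (xD (comp_descents alpha)).

Definition coinv_summand (alpha : seq nat) (p : Poly) : Prop :=
  exists a : FA, coinv_ideal (p - hecke_act a (summand_gen alpha)).

Definition proj_idem (alpha : seq nat) : FA :=
  Tword (rw (w0_of (comp_descents alpha))) *
  T'word (rw (w0_of (~: comp_descents alpha))).

Definition proj_indec (alpha : seq nat) (a : FA) : Prop :=
  exists b : FA, hecke_ideal (a - b * proj_idem alpha).

End WithReducedWords.
End Defs.

(* Main.v *)
(**
  Let D(w) be the descent set and e_D = T'_{w0(D^c)}.  Both x_D and e_D are
  killed by T_k for k outside D, so in either module T_j acts on the vectors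
  indexed by {w : D(w) = D} by the same formulas: the result is minus the
  vector of w, the vector of s_j w, or 0.  The isomorphisms follow once
  both families are known to be bases.

  Coinvariants.  F[x] is spanned over the symmetric polynomials by the
  elements pibar_w x_{D(w)}.  By induction on the norm sum_i m_i^2, every
  monomial is a combination of some pibar_w x^m with m dominant.  If m has a
  column of height i that is not forced by a descent of w, write
  x^m = (x^m / (x_1..x_i)) x_1..x_i and expand the product by e_i instead: the
  other terms have smaller norm or are of the form pibar_v x^m with v longer.
  The n! elements are then independent over the symmetric polynomials, since
  the matrix (v(pibar_w x_{D(w)})) is nonsingular by Dedekind's independence of
  automorphisms; hence they are a basis modulo the ideal.

  Hecke algebra.  The T_w span, and they are independent because pibar_w x^rho
  is x^{w rho} up to terms of smaller norm.  The elements T_w e_{D(w)} are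
  unitriangular in the T_w with respect to length, so they form a basis, too.
*)
Require Import Defs.
From HB Require Import structures.
From mathcomp Require Import all_boot all_order all_algebra all_fingroup.
From mathcomp Require Import monalg.
From mathcomp Require Import mpoly.
From mathcomp Require finmap.
From mathcomp Require Import zify ring.
From Stdlib Require Import ClassicalEpsilon.

Set Implicit Arguments.
Unset Strict Implicit.
Unset Printing Implicit Defensive.

Import GRing.Theory.
Local Open Scope ring_scope.

(** Products in ['S_n] apply the left factor first: [sgen j * w] is w s_j in the usual notation and
    [w * sgen j] is s_j w. Right descents govern the former, [Ldes] the latter. Quotients are never
    formed. A congruence is a statement [W (x - y)], and the braid and quadratic relations are
    assumed only modulo [W], so one computation with T_w serves every module that occurs. The
    summands are generated by T_{w0(D)} x_D and T_{w0(D)} e_D, whereas the convenient bases are T_w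
    x_D and T_w e_D. They are reconciled by T_w T_{w0(D)} = ± T_w whenever D(w) = D. Multiplying by
    e_i is legitimate because x^m / (x_1..x_i) has smaller norm, hence already lies in the span, and
    the span is stable under symmetric factors and under every pibar_w. The terms with longer v are
    harmless because lengths are bounded. *)

Ltac case_nat_eq :=
  repeat match goal with |- context [if ?a == ?b then _ else _] =>
    lazymatch a with
    | context [if _ then _ else _] => fail
    | _ => case: (eqVneq a b) => ?
    end
  end.

(** * Length, descents and reduced words in the symmetric group *)

Section SymmetricGroup.

Variable n : nat.
Implicit Types (w v : 'S_n) (j k : 'I_n.-1).

Local Notation len := (@perm_length n).
Local Notation Des w j := (w (hi j) < w (lo j))%N.

Lemma lt_lo_hi j : (lo j < hi j)%N. Proof. by []. Qed.

Lemma lo_neq_hi j : lo j != hi j.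
Proof. by rewrite -val_eqE /= neq_ltn ltnSn. Qed.

Lemma sgen_val j (p : 'I_n) : sgen j p =
  (if p == j :> nat then j.+1 else if p == j.+1 :> nat then nat_of_ord j else p) :> nat.
Proof.
rewrite /sgen; case: tpermP => [->|->|/eqP + /eqP +] /=.
- by rewrite eqxx.
- by rewrite eqxx gtn_eqF.
- by rewrite -!val_eqE /= => /negPf -> /negPf ->.
Qed.

Lemma sgenK j : (sgen j * sgen j = 1)%g. Proof. exact: tperm2. Qed.

Lemma sgenV j : ((sgen j)^-1 = sgen j)%g. Proof. exact: tpermV. Qed.

Lemma sgen_lo j : sgen j (lo j) = hi j. Proof. exact: tpermL. Qed.
Lemma sgen_hi j : sgen j (hi j) = lo j. Proof. exact: tpermR. Qed.

Lemma sgen_id j (p : 'I_n) : p != lo j -> p != hi j -> sgen j p = p.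
Proof. by move=> h1 h2; rewrite /sgen tpermD // eq_sym. Qed.

Lemma sgenKK j w : (sgen j * (sgen j * w) = w)%g.
Proof. by rewrite mulgA sgenK mul1g. Qed.

(** An adjacent transposition reverses the order of one pair only; the facts on lengths and on
    changing descent sets both rest on this. *)
Lemma sgen_ltn j (p q : 'I_n) : (p < q)%N ->
  (p == lo j) && (q == hi j) || (sgen j p < sgen j q)%N.
Proof.
move=> pq; rewrite !sgen_val -!val_eqE /=.
by case_nat_eq; lia.
Qed.

(** Applying s_j to both entries maps the inversions of [w] bijectively onto the inversions of
    [sgen j * w] other than [(lo j, hi j)], which is new. *)
Lemma len_up w j : (w (lo j) < w (hi j))%N -> len (sgen j * w)%g = (len w).+1.
Proof.
move=> wj; rewrite /perm_length.
set I' := [set p | _]; set I := [set p : _ * _ | _].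
pose phi (p : 'I_n * 'I_n) := (sgen j p.1, sgen j p.2).
have phiK : involutive phi by case=> p q; rewrite /phi /= /sgen !tpermK.
have -> : I' = (lo j, hi j) |: phi @: I.
  apply/setP => -[p q]; rewrite in_setU1 inE [(p, q).1]/= [(p, q).2]/= !permM.
  rewrite -[X in X \in phi @: _]phiK mem_imset ?inE /=; last exact: can_inj phiK.
  case: eqVneq => [[-> ->]|npq] /=.
    by rewrite sgen_lo sgen_hi wj lt_lo_hi.
  apply/andP/andP => -[pq wpq]; split=> //.
    have := sgen_ltn j pq; case/orP => // /andP[/eqP ep /eqP eq].
    by rewrite ep eq eqxx in npq.
  have := sgen_ltn j pq; rewrite /sgen !tpermK -/(sgen j).
  case/orP => // /andP[/eqP ep /eqP eq].
  by move: wpq; rewrite ep eq ltnNge ltnW.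
rewrite cardsU1 card_imset; last exact: can_inj phiK.
rewrite -[(lo j, hi j)]phiK mem_imset; last exact: can_inj phiK.
by rewrite inE /= sgen_lo sgen_hi ltnNge leqnSn.
Qed.

Lemma Des_sgen w j : Des (sgen j * w)%g j = ~~ Des w j.
Proof.
rewrite !permM sgen_lo sgen_hi -leqNgt [RHS]leq_eqVlt.
case: eqVneq => //= /ord_inj /perm_inj /eqP.
by rewrite (negPf (lo_neq_hi j)).
Qed.

Lemma Des_neg w j : ~~ Des w j -> (w (lo j) < w (hi j))%N.
Proof. by rewrite -Des_sgen !permM sgen_lo sgen_hi. Qed.

Lemma len_sgen w j : len (sgen j * w)%g = if Des w j then (len w).-1 else (len w).+1.
Proof.
case: ifPn => [d|/Des_neg]; last exact: len_up.
have /Des_neg : ~~ Des (sgen j * w)%g j by rewrite Des_sgen d.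
by move/len_up; rewrite sgenKK => ->.
Qed.

Lemma len1 : len 1%g = 0%N.
Proof.
apply/eqP; rewrite cards_eq0; apply/eqP/setP => -[p q]; rewrite !inE !perm1 /=.
by case: ltngtP.
Qed.

Lemma lenV w : len w^-1%g = len w.
Proof.
rewrite /perm_length -[RHS](@card_imset _ _ (fun p => (w p.2, w p.1))); last first.
  by move=> [a b] [c d] [/perm_inj -> /perm_inj ->].
apply: eq_card => -[p q]; rewrite inE /=.
apply/idP/imsetP => [/andP[h1 h2]|[[a b]]].
  by exists (w^-1%g q, w^-1%g p); rewrite ?inE /= ?permKV ?h1 ?h2.
by rewrite inE /= => /andP[h1 h2] [-> ->]; rewrite !permK h1 h2.
Qed.

(** Left descents of [w], that is, descents of the inverse: s_j w is shorter than w. *)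
Definition Ldes w j := (w^-1%g (hi j) < w^-1%g (lo j))%N.

Lemma len_sgenL w j :
  len (w * sgen j)%g = if Ldes w j then (len w).-1 else (len w).+1.
Proof. by rewrite -lenV invMg sgenV len_sgen lenV. Qed.

Lemma Ldes_sgen w j : Ldes (w * sgen j)%g j = ~~ Ldes w j.
Proof. by rewrite /Ldes invMg sgenV Des_sgen. Qed.

Lemma in_descents w j : (j \in descents w) = Des w j.
Proof. by rewrite inE. Qed.

Lemma word_perm_cons j u : word_perm (j :: u) = (word_perm u * sgen j)%g.
Proof. by []. Qed.

Lemma word_perm_cat (u1 u2 : seq 'I_n.-1) :
  word_perm (u1 ++ u2) = (word_perm u2 * word_perm u1)%g.
Proof. by elim: u1 => [|j u IH] /=; rewrite ?mulg1 // IH mulgA. Qed.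

Lemma word_perm_rcons u j : word_perm (rcons u j) = (sgen j * word_perm u)%g.
Proof. by rewrite -cats1 word_perm_cat /= mul1g. Qed.

Lemma len_word u : (len (word_perm u) <= size u)%N.
Proof.
elim: u => [|j u IH] /=; first by rewrite len1.
by rewrite len_sgenL; case: ifP => _; [apply: leq_trans (leq_pred _) (leqW IH)|].
Qed.

Lemma reducedP u w : reduced_word u w <-> word_perm u = w /\ size u = len w.
Proof. by split=> [/andP[/eqP + /eqP]|[? ?]] //; apply/andP; split; apply/eqP. Qed.

Lemma reduced_rcons u j w : reduced_word (rcons u j) w ->
  Des w j /\ reduced_word u (sgen j * w)%g.
Proof.
move=> /reducedP[ewp s]; rewrite word_perm_rcons in ewp; rewrite size_rcons in s.
have eu : word_perm u = (sgen j * w)%g by rewrite -ewp sgenKK.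
have := len_word u; rewrite eu len_sgen.
case: ifP => [d _|_]; last by rewrite -s ltnNge leqnSn.
by split=> //; apply/reducedP; rewrite eu len_sgen d -s.
Qed.

Lemma rcons_reduced u j w : ~~ Des w j -> reduced_word u w ->
  reduced_word (rcons u j) (sgen j * w)%g.
Proof.
move=> /negPf d /reducedP[e s]; apply/reducedP.
by rewrite word_perm_rcons size_rcons len_sgen e s d.
Qed.

Lemma cons_reduced u j w : ~~ Ldes w j -> reduced_word u w ->
  reduced_word (j :: u) (w * sgen j)%g.
Proof.
move=> /negPf d /reducedP[e s]; apply/reducedP.
by rewrite word_perm_cons /= len_sgenL e s d.
Qed.

Lemma sgen_comm j k : (j.+1 < k)%N || (k.+1 < j)%N ->
  (sgen j * sgen k = sgen k * sgen j)%g.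
Proof.
move=> jk; apply/permP => p; apply/ord_inj; rewrite !permM !sgen_val.
by case_nat_eq; lia.
Qed.

Lemma sgen_braid j k : k = j.+1 :> nat ->
  (sgen j * sgen k * sgen j = sgen k * sgen j * sgen k)%g.
Proof.
move=> jk; apply/permP => p; apply/ord_inj; rewrite !permM !sgen_val.
by case_nat_eq; lia.
Qed.

Lemma sgen_neq j k : j <> k -> ((j.+1 < k)%N || (k.+1 < j)%N) \/
  (k = j.+1 :> nat \/ j = k.+1 :> nat).
Proof.
move=> jk; have : j != k :> nat by apply/eqP => /ord_inj.
by lia.
Qed.

Lemma Des_comm w j k : (j.+1 < k)%N || (k.+1 < j)%N ->
  Des (sgen j * w)%g k = Des w k.
Proof.
move=> jk; rewrite !permM !sgen_id // -val_eqE /=; lia.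
Qed.

(** Descents at two adjacent places mean that w decreases on three consecutive positions, so both
    s_j s_k s_j and s_k s_j s_k can be split off on the right with the length dropping at each
    step. *)
Lemma Des_braid w j k : k = j.+1 :> nat -> Des w j -> Des w k ->
  [/\ Des (sgen j * w)%g k, Des (sgen k * (sgen j * w))%g j,
      Des (sgen k * w)%g j & Des (sgen j * (sgen k * w))%g k].
Proof.
move=> jk.
have -> : lo k = hi j by apply/ord_inj.
have lj : sgen k (lo j) = lo j by apply: sgen_id; rewrite -val_eqE /=; lia.
have lk : sgen j (hi k) = hi k by apply: sgen_id; rewrite -val_eqE /=; lia.
have hk : sgen k (hi j) = hi k.
  by have -> : hi j = lo k; [apply/ord_inj | rewrite sgen_lo].
rewrite !permM.
have hh : sgen k (hi k) = hi j by rewrite sgen_hi; apply/ord_inj.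
rewrite ?(lj, lk, hk, hh, sgen_lo, sgen_hi) => h1 h2; have := ltn_trans h2 h1.
by rewrite ?(lj, lk, hk, hh, sgen_lo, sgen_hi).
Qed.

End SymmetricGroup.

(** * Subspaces as predicates, and spanning families modulo a subspace *)

Section Submodules.

Variables (F : fieldType) (V : lmodType F) (W : V -> Prop).

Record submod : Prop := Submod {
  submod0 : W 0;
  submodDZ : forall (c : F) x y, W x -> W y -> W (c *: x + y) }.

Hypothesis sW : submod.

Lemma submodD x y : W x -> W y -> W (x + y).
Proof. by move=> hx hy; rewrite -[x]scale1r; apply: submodDZ. Qed.

Lemma submodZ c x : W x -> W (c *: x).
Proof. by move=> hx; rewrite -[c *: x]addr0; apply: submodDZ => //; apply: submod0. Qed.

Lemma submodN x : W x -> W (- x).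
Proof. by rewrite -scaleN1r; apply: submodZ. Qed.

Lemma submodB x y : W x -> W y -> W (x - y).
Proof. by move=> hx /submodN; apply: submodD. Qed.

Lemma submod_sum (I : Type) (r : seq I) (P : pred I) (f : I -> V) :
  (forall i, P i -> W (f i)) -> W (\sum_(i <- r | P i) f i).
Proof. by move=> h; apply: big_ind => //; [apply: submod0 | apply: submodD]. Qed.

Lemma submod_refl x : W (x - x).
Proof. by rewrite subrr; apply: submod0. Qed.

Lemma submod_sym x y : W (x - y) -> W (y - x).
Proof. by move/submodN; rewrite opprB. Qed.

Lemma submod_trans y x z : W (x - y) -> W (y - z) -> W (x - z).
Proof. by move=> h1 h2; rewrite -(subrKA y); apply: submodD. Qed.

Lemma submod_eqD x y x' y' : W (x - x') -> W (y - y') -> W (x + y - (x' + y')).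
Proof. by move=> h1 h2; rewrite opprD addrACA; apply: submodD. Qed.

Lemma submod_eqZ c x y : W (x - y) -> W (c *: x - c *: y).
Proof. by rewrite -scalerBr; apply: submodZ. Qed.

Lemma submod_eq_in x y : W (x - y) -> W y -> W x.
Proof. by move=> h1 h2; rewrite -(subrK y x); apply: submodD. Qed.

Lemma submod_eq_sum (I : Type) (r : seq I) (P : pred I) (f g : I -> V) :
  (forall i, P i -> W (f i - g i)) ->
  W (\sum_(i <- r | P i) f i - \sum_(i <- r | P i) g i).
Proof. by move=> h; rewrite -sumrB; apply: submod_sum. Qed.

Definition qspan (I : finType) (P : pred I) (b : I -> V) x :=
  exists c : I -> F, W (x - \sum_(i | P i) c i *: b i).

End Submodules.

Section Span.

Variables (F : fieldType) (V : lmodType F) (W : V -> Prop) (sW : submod W).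
Variables (I : finType) (P : pred I) (b : I -> V).

Lemma qspan_submod : submod (qspan W P b).
Proof.
split.
  exists (fun _ => 0); rewrite big1 ?subr0; first exact: submod0.
  by move=> i _; rewrite scale0r.
move=> a x y [c hc] [d hd]; exists (fun i => a * c i + d i).
under eq_bigr do rewrite scalerDl -scalerA.
rewrite big_split -scaler_sumr /=.
by apply: submod_eqD => //; apply: submod_eqZ.
Qed.

Lemma qspan_eq x y : W (x - y) -> qspan W P b y -> qspan W P b x.
Proof. by move=> h [c hc]; exists c; apply: submod_trans h hc. Qed.

Lemma qspan_base i : P i -> qspan W P b (b i).
Proof.
move=> Pi; exists (fun j => (j == i)%:R).
rewrite (bigD1 i) //= eqxx scale1r big1 ?addr0 ?subrr; first exact: submod0.
by move=> j /andP[_ /negPf ->]; rewrite scale0r.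
Qed.

End Span.

Lemma qspan_trans (F : fieldType) (V : lmodType F) (W : V -> Prop) (sW : submod W)
    (I J : finType) (P : pred I) (Q : pred J) (b : I -> V) (d : J -> V) x :
  (forall i, P i -> qspan W Q d (b i)) -> qspan W P b x -> qspan W Q d x.
Proof.
move=> h [c hc]; apply: (qspan_eq sW hc).
apply: submod_sum => [|i Pi]; first exact: qspan_submod.
by apply: submodZ; [apply: qspan_submod | apply: h].
Qed.

(* A spanning family has no more elements than an independent one has, so the
   change of basis matrix between them is square and invertible. *)
Lemma spanning_free (F : fieldType) (V : lmodType F) (W : V -> Prop) (I : finType)
    (f b : I -> V) : submod W ->
  (forall c : I -> F, W (\sum_i c i *: f i) -> forall i, c i = 0) ->
  (forall i, qspan W predT b (f i)) ->
  forall c : I -> F, W (\sum_i c i *: b i) -> forall i, c i = 0.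
Proof.
move=> sW ff fb.
have /fin_all_exists[A hA] : forall i, exists c : I -> F, W (f i - \sum_j c j *: b j).
  by move=> i; have [c] := fb i; exists c.
pose M : 'M[F]_(#|I|) := \matrix_(i, j) A (enum_val i) (enum_val j).
pose vec (c : I -> F) : 'rV[F]_#|I| := \row_i c (enum_val i).
have comb d : W (\sum_i d i *: f i - \sum_j (vec d *m M) 0 (enum_rank j) *: b j).
  apply: (@submod_trans _ _ _ sW (\sum_i d i *: \sum_j A i j *: b j)).
    by apply: submod_eq_sum => // i _; apply: submod_eqZ.
  have -> : \sum_i d i *: \sum_j A i j *: b j =
            \sum_j (vec d *m M) 0 (enum_rank j) *: b j.
    under eq_bigr do rewrite scaler_sumr.
    rewrite exchange_big; apply: eq_bigr => j _.
    rewrite mxE scaler_suml (reindex (@enum_val I predT)) /=; last first.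
      exact: onW_bij (enum_val_bij I).
    by apply: eq_bigr => i _; rewrite !mxE enum_rankK scalerA.
  exact: submod_refl.
(* A nonzero [v] with [v *m M = 0] would be a relation between the [f i] modulo [W]. *)
have dM : \det M != 0.
  apply/negP => /det0P[v nv vM]; case/negP: nv; apply/eqP/rowP => i.
  have := comb (fun i => v 0 (enum_rank i)).
  have -> : vec (fun i => v 0 (enum_rank i)) = v.
    by apply/rowP => j; rewrite !mxE enum_valK.
  rewrite vM [X in _ - X]big1 ?subr0; last by move=> j _; rewrite mxE scale0r.
  by move=> /ff /(_ (enum_val i)); rewrite enum_valK mxE.
have uM : M \in unitmx by rewrite unitmxE unitfE.
move=> c hc i.
(* This turns the relation [c] between the [b i] into a relation between the [f i]. *)
pose v := vec c *m invmx M.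
have ev : vec (fun i => v 0 (enum_rank i)) = v.
  by apply/rowP => j; rewrite !mxE enum_valK.
have vM : v *m M = vec c by rewrite mulmxKV.
have := comb (fun i => v 0 (enum_rank i)); rewrite ev vM => h.
have {}h : W (\sum_i v 0 (enum_rank i) *: f i).
  apply: (submod_eq_in sW h); under eq_bigr do rewrite mxE enum_rankK; exact: hc.
have v0 : v = 0.
  by apply/rowP => j; rewrite [RHS]mxE -(ff _ h (enum_val j)) enum_valK.
have /rowP/(_ (enum_rank i)) : vec c = 0 by rewrite -vM v0 mul0mx.
by rewrite !mxE enum_rankK.
Qed.

(** * Isomorphisms from bases with equal structure constants *)

Section BasisIso.

Variables (F : fieldType) (m : nat) (V1 V2 : lmodType F) (W1 S1 : V1 -> Prop)
  (W2 S2 : V2 -> Prop) (I : finType) (P : pred I) (b : I -> V1) (d : I -> V2)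
  (T1 : 'I_m -> V1 -> V1) (T2 : 'I_m -> V2 -> V2).
Hypotheses (sW1 : submod W1) (sW2 : submod W2).
Hypotheses (lT1 : forall j c x y, T1 j (c *: x + y) = c *: T1 j x + T1 j y)
           (lT2 : forall j c x y, T2 j (c *: x + y) = c *: T2 j x + T2 j y).
Hypothesis T1W : forall j x, W1 x -> W1 (T1 j x).

Lemma lin_sum (V U : lmodType F) (f : V -> U) :
  (forall c x y, f (c *: x + y) = c *: f x + f y) ->
  forall (Q : pred I) (c : I -> F) (g : I -> V),
  f (\sum_(i | Q i) c i *: g i) = \sum_(i | Q i) c i *: f (g i).
Proof.
move=> lf Q c g.
have f0 : f 0 = 0.
  by have := lf (-1) 0 0; rewrite scaler0 addr0 scaleN1r addNr.
have fD x y : f (x + y) = f x + f y by rewrite -{1}[x]scale1r lf scale1r.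
have fZ a x : f (a *: x) = a *: f x by rewrite -[a *: x]addr0 lf f0 addr0.
rewrite (big_morph f fD f0); apply: eq_bigr => i _; exact: fZ.
Qed.

(** The isomorphism sends [b i] to [d i]; it is equivariant because the same coefficients [g]
    describe both actions. Since [qiso] wants a map on representatives, coordinates are picked by
    choice, and freeness makes them unique. *)
Lemma basis_qiso : qbasis W1 S1 P b -> qbasis W2 S2 P d ->
  submod S1 -> (forall x, W1 x -> S1 x) -> submod S2 ->
  (forall j i, P i -> exists g : I -> F,
     W1 (T1 j (b i) - \sum_(k | P k) g k *: b k) /\
     W2 (T2 j (d i) - \sum_(k | P k) g k *: d k)) ->
  qiso W1 S1 T1 W2 S2 T2.
Proof.
move=> [bS bF bG] [dS dF dG] sS1 W1S sS2 struct.
pose co x := epsilon (inhabits (fun _ => 0)) (fun c : I -> F =>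
  W1 (x - \sum_(i | P i) c i *: b i)).
pose phi x := \sum_(i | P i) co x i *: d i.
have coP x : S1 x -> W1 (x - \sum_(i | P i) co x i *: b i).
  by move=> /bG h; apply: (epsilon_spec (inhabits (fun _ => 0)) _ h).
have couniq x c : W1 (x - \sum_(i | P i) c i *: b i) -> S1 x ->
    forall i, P i -> co x i = c i.
  move=> hc /coP h i Pi; apply/eqP; rewrite -subr_eq0; apply/eqP.
  apply: (bF (fun i => co x i - c i)) => //.
  under eq_bigr do rewrite scalerBl.
  rewrite sumrB; apply: (submod_trans sW1 _ hc); exact: submod_sym.
have phiE x c : W1 (x - \sum_(i | P i) c i *: b i) -> phi x = \sum_(i | P i) c i *: d i.
  move=> hc; apply: eq_bigr => i Pi; congr (_ *: _); apply: (couniq _ _ hc _ _ Pi).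
  apply: (submod_eq_in sS1 (W1S _ hc)).
  by apply: submod_sum => // k Pk; apply: submodZ => //; apply: bS.
exists phi; split.
- by move=> x _; apply: submod_sum => // i Pi; apply: submodZ => //; apply: dS.
- move=> c x y Sx Sy; rewrite (phiE _ (fun i => c * co x i + co y i)).
    rewrite /phi scaler_sumr -big_split /=; under [X in X - _]eq_bigr do rewrite scalerDl -scalerA.
    exact: submod_refl.
  under [X in _ - X]eq_bigr do rewrite scalerDl -scalerA.
  rewrite big_split -scaler_sumr /=; apply: submod_eqD (coP _ Sy) => //.
  by apply: submod_eqZ => //; apply: coP.
- move=> x Sx; split=> [/dF c0 | Wx].
    apply: (submod_eq_in sW1 (coP _ Sx)); rewrite big1; first exact: submod0.
    by move=> i /c0 ->; rewrite scale0r.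
  rewrite (phiE _ (fun => 0)) big1 ?subr0 //; first exact: submod0.
  1,2: by move=> i _; rewrite scale0r.
- move=> y /dG[c hc]; exists (\sum_(i | P i) c i *: b i).
    by apply: submod_sum => // i Pi; apply: submodZ => //; apply: bS.
  by rewrite (phiE _ c) //; apply: submod_refl.
move=> j x Sx.
have /fin_all_exists[g hg] : forall i, exists g : I -> F, P i ->
     W1 (T1 j (b i) - \sum_(k | P k) g k *: b k) /\
     W2 (T2 j (d i) - \sum_(k | P k) g k *: d k).
  move=> i; have [/struct - /(_ j)[g hg]|//] := boolP (P i); first by exists g.
  by exists (fun => 0).
have swap (V : lmodType F) (f : I -> V) :
    \sum_(i | P i) co x i *: \sum_(k | P k) g i k *: f k =
    \sum_(k | P k) (\sum_(i | P i) co x i * g i k) *: f k.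
  under eq_bigr do rewrite scaler_sumr.
  rewrite exchange_big /=; apply: eq_bigr => k _; rewrite scaler_suml.
  by apply: eq_bigr => i _; rewrite scalerA.
rewrite (phiE _ (fun k => \sum_(i | P i) co x i * g i k)).
  rewrite /phi lin_sum // -swap; apply: submod_sym => //.
  by apply: submod_eq_sum => // i /hg[_ h]; apply: submod_eqZ.
rewrite -swap; apply: (@submod_trans _ _ _ sW1 (T1 j (\sum_(i | P i) co x i *: b i))).
  have lT1B u v : T1 j (u - v) = T1 j u - T1 j v.
    by rewrite addrC -scaleN1r lT1 scaleN1r addrC.
  by rewrite -lT1B; apply/T1W/coP.
rewrite lin_sum //.
by apply: submod_eq_sum => // i /hg[h _]; apply: submod_eqZ.
Qed.

End BasisIso.

(** * The operators T_w and their independence of the reduced word *)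

Section BraidModule.

Variables (F : fieldType) (n : nat) (V : lmodType F) (W : V -> Prop).
Implicit Types (T : 'I_n.-1 -> V -> V) (u v : seq 'I_n.-1) (w : 'S_n).

Definition act T u x : V := foldr (fun j y => T j y) x u.

(* The relations are only required modulo W, so that the polynomial ring, the
   coinvariant algebra and F<T_1..T_(n-1)> modulo the Hecke relations are instances. *)
Record braid_module T : Prop := BraidModule {
  bm_sub : submod W;
  bm_lin : forall j c x y, T j (c *: x + y) = c *: T j x + T j y;
  bm_stable : forall j x, W x -> W (T j x);
  bm_comm : forall (j k : 'I_n.-1) x, (j.+1 < k)%N || (k.+1 < j)%N ->
    W (T j (T k x) - T k (T j x));
  bm_braid : forall (j k : 'I_n.-1) x, k = j.+1 :> nat ->
    W (T j (T k (T j x)) - T k (T j (T k x))) }.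

Record hecke_module T : Prop := HeckeModule {
  hm_braid : braid_module T;
  hm_quad : forall j x, W (T j (T j x) + T j x) }.

Variable T : 'I_n.-1 -> V -> V.
Hypothesis bT : braid_module T.
Let sW := bm_sub bT.

Lemma bm_linB j x y : T j (x - y) = T j x - T j y.
Proof. by rewrite addrC -scaleN1r (bm_lin bT) scaleN1r addrC. Qed.

Lemma bm_0 j : T j 0 = 0.
Proof. by have := bm_linB j 0 0; rewrite !subrr. Qed.

Lemma bm_linZ j c x : T j (c *: x) = c *: T j x.
Proof. by rewrite -[c *: x]addr0 (bm_lin bT) bm_0 addr0. Qed.

Lemma bm_eq j x y : W (x - y) -> W (T j x - T j y).
Proof. by rewrite -bm_linB; apply: bm_stable. Qed.

Lemma act_rcons u j x : act T (rcons u j) x = act T u (T j x).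
Proof. exact: foldr_rcons. Qed.

Lemma act_linB u x y : act T u (x - y) = act T u x - act T u y.
Proof. by elim: u => //= j u ->; rewrite bm_linB. Qed.

Lemma act_linZ u c x : act T u (c *: x) = c *: act T u x.
Proof. by elim: u => //= j u ->; rewrite bm_linZ. Qed.

Lemma act_lin u c x y : act T u (c *: x + y) = c *: act T u x + act T u y.
Proof. by elim: u => //= j u ->; rewrite (bm_lin bT). Qed.

Lemma act_stable u x : W x -> W (act T u x).
Proof. by move=> hx; elim: u => //= j u; apply: bm_stable. Qed.

Lemma act_eq u x y : W (x - y) -> W (act T u x - act T u y).
Proof. by rewrite -act_linB; apply: act_stable. Qed.

Variable rw : 'S_n -> seq 'I_n.-1.
Hypothesis hrw : forall w : 'S_n, reduced_word (rw w) w.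

(** Matsumoto's theorem, by induction on length. If the last letters j and k differ, both are
    descents of w, so w has reduced words that share a prefix [z] and end in the two sides of the
    commutation or braid relation for j and k. The induction hypothesis links each given word to the
    one of these with the same last letter. *)
Lemma act_reduced w u v x : reduced_word u w -> reduced_word v w ->
  W (act T u x - act T v x).
Proof.
elim: {u}(size u) {-2}u (erefl (size u)) w v x => [|m IH] u su w v x.
  have/size0nil -> := su.
  move=> /reducedP[_ e1] /reducedP[_]; rewrite -e1 => /size0nil ->.
  exact: submod_refl.
case/lastP: u su => // u j; rewrite size_rcons => -[su] ru rv.
case/lastP: v rv => [|v k] rv.
  have /reducedP[_ e1] := ru; have /reducedP[_ e2] := rv.
  by rewrite -e1 size_rcons in e2.
have sv : size v = m.
  have /reducedP[_ e1] := ru; have /reducedP[_ e2] := rv.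
  by rewrite -e1 !size_rcons su in e2; case: e2.
have [dj {}ru] := reduced_rcons ru; have [dk {}rv] := reduced_rcons rv.
rewrite !act_rcons.
have [ejk|/eqP njk] := eqVneq j k.
  by rewrite -ejk in rv *; apply: IH ru rv.
have step u1 u2 w1 y : size u1 = m -> reduced_word u1 w1 -> reduced_word u2 w1 ->
  W (act T u1 y - act T u2 y) by move=> s1 r1 r2; apply: IH r1 r2.
case: (sgen_neq njk) => [c|].
  have dkj : ((sgen j * w)%g (hi k) < (sgen j * w)%g (lo k))%N by rewrite Des_comm.
  have djk : ((sgen k * w)%g (hi j) < (sgen k * w)%g (lo j))%N.
    by rewrite Des_comm // orbC.
  pose z := rw (sgen k * (sgen j * w))%g.
  have rz1 : reduced_word (rcons z k) (sgen j * w)%g.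
    rewrite -[X in reduced_word _ X](sgenKK k).
    by apply: rcons_reduced (hrw _); rewrite Des_sgen dkj.
  have rz2 : reduced_word (rcons z j) (sgen k * w)%g.
    rewrite -[X in reduced_word _ X](sgenKK j).
    apply: rcons_reduced; first by rewrite Des_sgen djk.
    by rewrite mulgA sgen_comm // -mulgA; apply: hrw.
  apply: (submod_trans sW (step _ _ _ _ su ru rz1)); rewrite act_rcons.
  apply: (@submod_trans _ _ _ sW (act T z (T j (T k x)))); last first.
    rewrite -act_rcons; apply: submod_sym => //; exact: step rv rz2.
  by apply/act_eq/(bm_comm bT); rewrite orbC.
(* The claim is symmetric in the two words, so the adjacent generators may be put in order. *)
wlog jk : j k u v dj dk ru rv su sv njk step / k = j.+1 :> nat.
  move=> wl [jk|jk]; first by apply: (wl j k) => //; left.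
  by apply: submod_sym => //; apply: (wl k j) => //; [move=> e; apply: njk | left].
move=> _; have [d1 d2 d3 d4] := Des_braid jk dj dk.
pose z := rw (sgen j * (sgen k * (sgen j * w)))%g.
have rz0 : reduced_word (rcons z j) (sgen k * (sgen j * w))%g.
  rewrite -[X in reduced_word _ X](sgenKK j).
  by apply: rcons_reduced (hrw _); rewrite Des_sgen d2.
have rz1 : reduced_word (rcons (rcons z j) k) (sgen j * w)%g.
  rewrite -[X in reduced_word _ X](sgenKK k).
  by apply: rcons_reduced rz0; rewrite Des_sgen d1.
have rz0' : reduced_word (rcons z k) (sgen j * (sgen k * w))%g.
  rewrite -[X in reduced_word _ X](sgenKK k).
  apply: rcons_reduced; first by rewrite Des_sgen d4.
  by rewrite !mulgA -(sgen_braid jk) -!mulgA; apply: hrw.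
have rz2 : reduced_word (rcons (rcons z k) j) (sgen k * w)%g.
  rewrite -[X in reduced_word _ X](sgenKK j).
  by apply: rcons_reduced rz0'; rewrite Des_sgen d3.
apply: (submod_trans sW (step _ _ _ _ su ru rz1)); rewrite !act_rcons.
apply: (@submod_trans _ _ _ sW (act T z (T k (T j (T k x))))).
  exact/act_eq/(bm_braid bT).
have <- : act T (rcons (rcons z k) j) (T k x) = act T z (T k (T j (T k x))).
  by rewrite !act_rcons.
by apply: submod_sym => //; apply: step rv rz2.
Qed.

Definition actw w x := act T (rw w) x.

Lemma actw_up w j x : ~~ (w (hi j) < w (lo j))%N ->
  W (actw w (T j x) - actw (sgen j * w)%g x).
Proof.
by move=> d; rewrite /actw -act_rcons; apply: act_reduced (hrw _); apply: rcons_reduced.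
Qed.

Lemma actwL_up w j x : ~~ Ldes w j -> W (T j (actw w x) - actw (w * sgen j)%g x).
Proof.
move=> d; rewrite /actw -[T j _]/(act T (j :: rw w) x).
by apply: act_reduced (hrw _); apply: cons_reduced.
Qed.

Lemma actw_kill w j x : (w (hi j) < w (lo j))%N -> W (T j x) -> W (actw w x).
Proof.
move=> d hx; rewrite -[w](sgenKK j).
apply: (submod_eq_in sW (submod_sym sW (actw_up _ _))); first by rewrite Des_sgen d.
exact: act_stable.
Qed.

End BraidModule.

(** * The 0-Hecke action on the vectors of one descent class *)

Section HeckeModule.

Variables (F : fieldType) (n : nat) (V : lmodType F) (W : V -> Prop).
Variable T : 'I_n.-1 -> V -> V.
Hypothesis hT : hecke_module W T.
Let bT := hm_braid hT.
Let sW := bm_sub bT.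
Variable rw : 'S_n -> seq 'I_n.-1.
Hypothesis hrw : forall w : 'S_n, reduced_word (rw w) w.
Local Notation actw := (actw T rw).
Implicit Types (w : 'S_n) (D : {set 'I_n.-1}).

Lemma hm_quadN j x : W (T j (T j x) - (- T j x)).
Proof. by rewrite opprK; apply: (hm_quad hT). Qed.

Lemma submod_eqN x y : W (x - y) -> W (- x - - y).
Proof. by rewrite -opprD; apply: submodN. Qed.

Lemma act_linN u x : act T u (- x) = - act T u x.
Proof. by rewrite -scaleN1r (act_linZ bT) scaleN1r. Qed.

Lemma actw_down w j x : (w (hi j) < w (lo j))%N ->
  W (actw w (T j x) - (- actw w x)).
Proof.
move=> d; have d1 : ~~ ((sgen j * w)%g (hi j) < (sgen j * w)%g (lo j))%N.
  by rewrite Des_sgen d.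
have up y : W (actw w y - actw (sgen j * w)%g (T j y)).
  by apply: submod_sym => //; rewrite -{2}[w](sgenKK j); apply: actw_up.
apply: (submod_trans sW (up _)).
apply: (@submod_trans _ _ _ sW (- actw (sgen j * w)%g (T j x))).
  by rewrite -[X in _ - X]act_linN; apply: act_eq => //; apply: hm_quadN.
by apply: submod_eqN; apply: submod_sym.
Qed.

Lemma actwL_down w j x : Ldes w j -> W (T j (actw w x) - (- actw w x)).
Proof.
move=> d; have d1 : ~~ Ldes (w * sgen j)%g j by rewrite Ldes_sgen d.
have up : W (actw w x - T j (actw (w * sgen j)%g x)).
  apply: submod_sym => //.
  by have := actwL_up bT hrw x d1; rewrite -mulgA sgenK mulg1.
apply: (submod_trans sW (bm_eq bT j up)).
apply: (submod_trans sW (hm_quadN _ _)).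
by apply: submod_eqN; apply: submod_sym.
Qed.

(** With [u] a reduced word of w0(D(w)), this puts T_w x into the submodule generated by
    T_{w0(D(w))} x. *)
Lemma actw_absorb w u x : all (fun j : 'I_n.-1 => w (hi j) < w (lo j))%N u ->
  W (actw w (act T u x) - (-1) ^+ size u *: actw w x).
Proof.
elim: u => /= [_|j u IH /andP[dj /IH {}IH]].
  by rewrite expr0 scale1r; apply: submod_refl.
apply: (submod_trans sW (actw_down _ dj)).
by rewrite exprS mulN1r scaleNr; apply: submod_eqN.
Qed.

(* Multiplying w by s_j on the left either keeps the descent set, or equals
   right multiplication by some s_k with k outside it. *)
Lemma descentsL w j : ~~ Ldes w j -> descents (w * sgen j)%g <> descents w ->
  exists2 k, k \notin descents w & (w * sgen j = sgen k * w)%g.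
Proof.
move=> dj nD.
have /existsP[k hk] : [exists k, (k \in descents (w * sgen j)%g) != (k \in descents w)].
  apply: contra_notT nD; rewrite negb_exists => /forallP h.
  by apply/setP => k; have := h k; rewrite negbK => /eqP.
have nlh := lo_neq_hi k.
have wn : w (lo k) != w (hi k) by rewrite (inj_eq perm_inj).
(* Only the values [lo j] and [hi j] change their order under s_j, so these are the values of w at k
   and k+1; they occur in increasing order because j is not a left descent. *)
have {hk} [e1 e2] : w (lo k) = lo j /\ w (hi k) = hi j.
  have dj' : (w^-1%g (lo j) < w^-1%g (hi j))%N.
    by have := dj; rewrite /Ldes -leqNgt leq_eqVlt => /orP[/eqP /ord_inj /perm_inj /eqP|//];
       rewrite (negPf (lo_neq_hi j)).
  move: hk; rewrite !in_descents !permM.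
  have hlt := sgen_ltn j (p := w (lo k)) (q := w (hi k)).
  have hgt := sgen_ltn j (p := w (hi k)) (q := w (lo k)).
  case: (ltngtP (w (lo k)) (w (hi k))) => [lt|gt|/ord_inj e]; last by rewrite e eqxx in wn.
    case/orP: (hlt lt) => [/andP[/eqP -> /eqP ->] //|l1].
    by rewrite ltnNge (ltnW l1).
  case/orP: (hgt gt) => [/andP[/eqP e1 /eqP e2]|->]; last by [].
  by move: dj'; rewrite -e1 -e2 !permK /= ltnNge leqnSn.
exists k; last first.
  apply/permP => p; rewrite !permM.
  have [->|n1] := eqVneq p (lo k); first by rewrite sgen_lo e1 e2 sgen_lo.
  have [->|n2] := eqVneq p (hi k); first by rewrite sgen_hi e1 e2 sgen_hi.
  rewrite [sgen k p]sgen_id // sgen_id //.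
    by rewrite -e1 (inj_eq perm_inj).
  by rewrite -e2 (inj_eq perm_inj).
by rewrite in_descents e1 e2 /= ltnNge leqnSn.
Qed.

Variables (D : {set 'I_n.-1}) (x : V).
Hypothesis xD : forall k, k \notin D -> W (T k x).

Definition act_coeff D j w w' : F :=
  if Ldes w j then - (w' == w)%:R
  else ((descents (w * sgen j)%g == D) && (w' == w * sgen j)%g)%:R.

(** When s_j w leaves the descent class it equals w s_k with k outside D, so T_j T_w x = T_w T_k x,
    which vanishes modulo [W]. *)
Lemma act_actw j w : descents w = D ->
  W (T j (actw w x) - \sum_(w' | descents w' == D) act_coeff D j w w' *: actw w' x).
Proof.
move=> wD; rewrite /act_coeff; case: (boolP (Ldes w j)) => d.
  rewrite (bigD1 w) /=; last exact/eqP.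
  rewrite eqxx scaleN1r [X in _ - (_ + X)]big1 ?addr0; first exact: actwL_down.
  by move=> w' /andP[_ /negPf ->]; rewrite oppr0 scale0r.
case: (descents (w * sgen j)%g =P D) => [sD|nD] /=.
  rewrite (bigD1 (w * sgen j)%g) /=; last exact/eqP.
  rewrite eqxx scale1r [X in _ - (_ + X)]big1 ?addr0; first exact: actwL_up.
  by move=> w' /andP[_ /negPf ->]; rewrite scale0r.
rewrite big1 ?subr0; last by move=> w' _; rewrite scale0r.
rewrite -wD in nD; have [k nk e] := descentsL d nD.
apply: (submod_eq_in sW (actwL_up bT hrw _ d)); rewrite e.
have nk' := nk; rewrite in_descents in nk'.
apply: (submod_eq_in sW (submod_sym sW (actw_up bT hrw _ nk'))).
by apply: act_stable => //; apply: xD; rewrite -wD.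
Qed.

Lemma act_span u y : qspan W (fun w => descents w == D) (fun w => actw w x) y ->
  qspan W (fun w => descents w == D) (fun w => actw w x) (act T u y).
Proof.
move=> hy; elim: u => //= j u [c hc].
apply: (qspan_eq sW (bm_eq bT j hc)); rewrite (lin_sum (bm_lin bT j)).
apply: submod_sum => [|w /eqP wD]; first exact: qspan_submod.
apply: submodZ; first exact: qspan_submod.
by eexists; apply: act_actw wD.
Qed.

End HeckeModule.

(** * Longest elements of parabolic subgroups *)

Section Parabolic.

Variable n : nat.
Implicit Types (D : {set 'I_n.-1}).

Local Notation par D := (<<[set sgen j | j in D]>>%g).

Lemma par_sgen D j : j \in D -> sgen j \in par D.
Proof. by move=> jD; apply/mem_gen/imset_f. Qed.

(** The permutations preserving the cut after position k form a group, and it contains every s_j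
    with j different from k. *)
Lemma par_preserve D k (g : 'S_n) : k \notin D -> g \in par D ->
  forall p, (g p <= k)%N = (p <= k)%N.
Proof.
move=> kD.
pose A := [set g : 'S_n | [forall p, (g p <= k)%N == (p <= k)%N]].
have Ag : group_set A.
  apply/group_setP; split=> [|g1 g2]; rewrite !inE.
    by apply/forallP => p; rewrite perm1.
  move=> /forallP h1 /forallP h2; apply/forallP => p.
  by rewrite permM (eqP (h2 _)) (eqP (h1 _)).
have /subsetP sub : par D \subset Group Ag.
  rewrite gen_subG; apply/subsetP => _ /imsetP[j jD ->]; rewrite inE.
  apply/forallP => p; rewrite sgen_val.
  have : j != k by apply: contraNneq kD => <-.
  by rewrite -val_eqE /= => jk; apply/eqP; case_nat_eq; lia.
by move=> /sub; rewrite inE => /forallP h p; rewrite (eqP (h p)).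
Qed.

Lemma par_descents D (g : 'S_n) : g \in par D -> descents g \subset D.
Proof.
move=> gD; apply/subsetP => k; rewrite in_descents; apply: contraLR => kD.
have := par_preserve kD gD (lo k); have := par_preserve kD gD (hi k).
by rewrite /= leqnn ltnn; lia.
Qed.

Lemma w0_ofP D : w0_of D \in par D /\
  forall g, g \in par D -> (perm_length g <= perm_length (w0_of D))%N.
Proof.
rewrite /w0_of; case: arg_maxnP; first exact: group1.
by move=> g gD h; split.
Qed.

(** If some j in D were not a descent, multiplying by s_j would give a longer element of the
    subgroup. *)
Lemma descents_w0 D : descents (w0_of D) = D.
Proof.
have [gD gmax] := w0_ofP D.
apply/eqP; rewrite eqEsubset par_descents //=; apply/subsetP => j jD.
rewrite in_descents; have := gmax _ (groupM (par_sgen jD) gD).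
by rewrite len_sgen; case: ifP => // _; rewrite ltnn.
Qed.

Lemma Ldes_w0 D j : j \in D -> Ldes (w0_of D) j.
Proof.
move=> jD; have [gD gmax] := w0_ofP D.
have := gmax _ (groupM gD (par_sgen jD)).
by rewrite len_sgenL; case: ifP => // _; rewrite ltnn.
Qed.

(** The last letter of a reduced word is a descent, hence lies in D, and removing it stays inside
    the subgroup. *)
Lemma par_letters D u (g : 'S_n) : g \in par D -> reduced_word u g ->
  all (fun j => j \in D) u.
Proof.
elim/last_ind: u g => // u j IH g gD r.
have [d r'] := reduced_rcons r.
have jD : j \in D by apply: (subsetP (par_descents gD)); rewrite in_descents.
by rewrite all_rcons jD /=; apply: IH r'; apply: groupM => //; apply: par_sgen.
Qed.

End Parabolic.

(** * Polynomial identities behind the braid relation *)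

Section BraidIdentity.

Variables (R : idomainType) (a b c Y tY sY xY Z sZ U f1 fs ft fst fts fsts : R).

(** Here a, b, c stand for three consecutive variables and [f1], [fs], ..., [fsts] for the images of
    f under S_3. [Y], [Z], [U] are the results of one, two and three operators; [sY], [tY], [xY],
    [sZ] are images of [Y] and [Z] under permutations. Each hypothesis is a Demazure equation with
    its denominator cleared. [braid_idr] treats the other order and reaches the same right-hand
    side. *)
Lemma braid_idl : a - b != 0 ->
  (a - b) * Y = b * (f1 - fs) -> (a - c) * tY = c * (ft - fst) ->
  (b - a) * sY = a * (fs - f1) -> (b - c) * xY = c * (fts - fsts) ->
  (b - c) * Z = c * (Y - tY) -> (a - c) * sZ = c * (sY - xY) ->
  (a - b) * U = b * (Z - sZ) ->
  (a - b) * (b - c) * (a - c) * U = b * c ^+ 2 * (f1 - fs - ft + fst + fts - fsts).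
Proof.
move=> nab hY ht hs hx hZ hsZ hU.
(* In this combination the factor a - b cancels, so no denominator is left. *)
have e : (a - c) * Y - (b - c) * sY = c * (f1 - fs).
  apply: (mulfI nab).
  have -> : (a - b) * ((a - c) * Y - (b - c) * sY) =
    (a - c) * ((a - b) * Y) + (b - c) * ((b - a) * sY) by ring.
  by rewrite hY hs; ring.
have -> : (a - b) * (b - c) * (a - c) * U = (b - c) * (a - c) * ((a - b) * U) by ring.
rewrite hU; have -> : (b - c) * (a - c) * (b * (Z - sZ)) =
  b * ((a - c) * ((b - c) * Z) - (b - c) * ((a - c) * sZ)) by ring.
rewrite hZ hsZ; have -> : b * ((a - c) * (c * (Y - tY)) - (b - c) * (c * (sY - xY))) =
  b * c * (((a - c) * Y - (b - c) * sY) - (a - c) * tY + (b - c) * xY) by ring.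
by rewrite e ht hx; ring.
Qed.

Lemma braid_idr : b - c != 0 ->
  (b - c) * Y = c * (f1 - ft) -> (a - c) * sY = c * (fs - fts) ->
  (c - b) * tY = b * (ft - f1) -> (a - b) * xY = b * (fst - fsts) ->
  (a - b) * Z = b * (Y - sY) -> (a - c) * sZ = c * (tY - xY) ->
  (b - c) * U = c * (Z - sZ) ->
  (a - b) * (b - c) * (a - c) * U = b * c ^+ 2 * (f1 - fs - ft + fst + fts - fsts).
Proof.
move=> nbc hY hs ht hx hZ hsZ hU.
have e : (a - c) * b * Y - (a - b) * c * tY = b * c * (f1 - ft).
  apply: (mulfI nbc).
  have -> : (b - c) * ((a - c) * b * Y - (a - b) * c * tY) =
    (a - c) * b * ((b - c) * Y) + (a - b) * c * ((c - b) * tY) by ring.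
  by rewrite hY ht; ring.
have -> : (a - b) * (b - c) * (a - c) * U = (a - b) * (a - c) * ((b - c) * U) by ring.
rewrite hU; have -> : (a - b) * (a - c) * (c * (Z - sZ)) =
  c * ((a - c) * ((a - b) * Z) - (a - b) * ((a - c) * sZ)) by ring.
rewrite hZ hsZ; have -> : c * ((a - c) * (b * (Y - sY)) - (a - b) * (c * (tY - xY))) =
  c * (((a - c) * b * Y - (a - b) * c * tY) - b * ((a - c) * sY) + c * ((a - b) * xY))
  by ring.
by rewrite e hs hx; ring.
Qed.

End BraidIdentity.

(** * Demazure operators satisfy the 0-Hecke relations *)

Section Demazure.

Local Notation "m # s" := [multinom m (s i) | i < _]
  (at level 40, left associativity, format "m # s").

Variables (F : fieldType) (n : nat).
Local Notation P := {mpoly F[n]}.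
Implicit Types (f g : P) (m : 'X_{1..n}) (j k : 'I_n.-1).

Local Notation s_ j := (msym (sgen j)).
Local Notation xl j := ('X_(lo j) : P).
Local Notation xh j := ('X_(hi j) : P).
Local Notation pb := (@demazure_bar F n).

Lemma msymXi (w : 'S_n) (i : 'I_n) : msym w ('X_i : P) = 'X_(w i).
Proof.
rewrite msymX; congr mpolyX; apply/mnmP => a.
by rewrite mnmE !mnm1E -(inj_eq (@perm_inj _ w)) permKV.
Qed.

Lemma subX_neq0 (a b : 'I_n) : a != b -> ('X_a - 'X_b : P) != 0.
Proof.
move=> ab; rewrite subr_eq0; apply: contraNneq ab => /(congr1 (mcoeff U_(a))).
by rewrite !mcoeffXU eqxx eq_sym; case: eqP => //= _ /eqP; rewrite oner_eq0.
Qed.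

Lemma subX_lo_hi_neq0 j : xl j - xh j != 0.
Proof. exact/subX_neq0/lo_neq_hi. Qed.

Lemma msym_sgenK j f : s_ j (s_ j f) = f.
Proof. by rewrite -msymMm sgenK msym1m. Qed.

Lemma msym_Xlo j : s_ j (xl j) = xh j. Proof. by rewrite msymXi sgen_lo. Qed.
Lemma msym_Xhi j : s_ j (xh j) = xl j. Proof. by rewrite msymXi sgen_hi. Qed.

(** The exponents on the segment from m to s_j m. For m_{hi} <= m_{lo}, pibar_j x^m is the sum over
    0 < t <= m_{lo} - m_{hi}, by the telescoping of [mshift_tele]. *)
Definition mshift m j t : 'X_{1..n} :=
  [multinom (if i == lo j then m i - t else if i == hi j then m i + t else m i)%N | i < n].

Lemma mshift0 m j : mshift m j 0 = m.
Proof. by apply/mnmP => i; rewrite mnmE subn0 addn0 !if_same. Qed.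

Lemma mshiftS m j t : (t < m (lo j))%N ->
  xl j * 'X_[mshift m j t.+1] = xh j * 'X_[mshift m j t].
Proof.
move=> tm; rewrite -!mpolyXD; congr mpolyX; apply/mnmP => i.
rewrite !mnmDE !mnm1E !mnmE; have := lo_neq_hi j.
case: (eqVneq i (lo j)) => [->|] //.
  by rewrite eq_sym => /negPf ->; lia.
by move=> ni nlh; case: eqVneq => _ /=; lia.
Qed.

Lemma mperm_sgen m j : (m (hi j) <= m (lo j))%N ->
  mshift m j (m (lo j) - m (hi j)) = m#(sgen j).
Proof.
move=> le; apply/mnmP => i; rewrite !mnmE.
case: eqVneq => [->|n1]; first by rewrite sgen_lo; lia.
case: eqVneq => [->|n2]; first by rewrite sgen_hi; lia.
by rewrite sgen_id.
Qed.

Lemma mshift_tele m j d : (d <= m (lo j))%N ->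
  (xl j - xh j) * (\sum_(t < d) 'X_[mshift m j t.+1]) =
  xh j * ('X_[m] - 'X_[mshift m j d]).
Proof.
elim: d => [|d IH] le; first by rewrite big_ord0 mshift0 subrr !mulr0.
rewrite big_ord_recr /= mulrDr IH; last exact: ltnW.
by rewrite [X in _ + X]mulrBl mshiftS //; ring.
Qed.

(** [demazure] selects a quotient by choice, so divisibility has to be established before its
    defining equation can be used. The monomials with m_{hi} <= m_{lo} telescope; the others are
    s_j-images of these, for which the quotient changes sign. *)
Lemma dbar_exists j f : exists g, (xl j - xh j) * g = xh j * (f - s_ j f).
Proof.
have hs f1 : (exists g, (xl j - xh j) * g = xh j * (f1 - s_ j f1)) ->
    (exists g, (xl j - xh j) * g = xh j * (s_ j f1 - s_ j (s_ j f1))).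
  by case=> g hg; exists (- g); rewrite msym_sgenK mulrN hg -mulrN opprB.
have hX m : exists g, (xl j - xh j) * g = xh j * ('X_[m] - s_ j 'X_[m]).
  wlog le : m / (m (hi j) <= m (lo j))%N.
    move=> wl; case: (leqP (m (hi j)) (m (lo j))) => [|lt]; first exact: wl.
    have -> : 'X_[m] = s_ j 'X_[m#(sgen j)] :> P.
      rewrite msymX; congr mpolyX; apply/mnmP => i.
      by rewrite !mnmE permKV.
    by apply/hs/wl; rewrite !mnmE sgen_hi sgen_lo ltnW.
  exists (\sum_(t < m (lo j) - m (hi j)) 'X_[mshift m j t.+1]).
  by rewrite mshift_tele ?leq_subr // mperm_sgen // msymX sgenV.
elim/mpolyind: f => [|c m p _ _ [g hg]].
  by exists 0; rewrite msym0 subrr !mulr0.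
have [h hh] := hX m.
exists (c *: h + g); rewrite mulrDr hg -scalerAr hh scalerAr -mulrDr.
by rewrite msymD msymZ scalerBr; congr (_ * _); ring.
Qed.

(** Subtracting (x_i - x_{i+1}) f from the equation of pi_i leaves this form. The properties of
    pibar_i below follow from it by cancelling x_i - x_{i+1}. *)
Lemma dbarE j f : (xl j - xh j) * pb j f = xh j * (f - s_ j f).
Proof.
rewrite /demazure_bar /demazure.
set Q := (fun g : Defs.Poly F n => _).
have : exists g, Q g.
  have [g hg] := dbar_exists j f; exists (f + g); rewrite /Q mulrDr hg; ring.
move=> /(epsilon_spec (inhabits 0)); set g0 := epsilon _ _; rewrite /Q => h.
by rewrite mulrBr h; ring.
Qed.

Lemma dbar_uniq j f g : (xl j - xh j) * g = xh j * (f - s_ j f) -> pb j f = g.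
Proof. by move=> h; apply: (mulfI (subX_lo_hi_neq0 j)); rewrite dbarE h. Qed.

Lemma dbar_lin j c f g : pb j (c *: f + g) = c *: pb j f + pb j g.
Proof.
apply: dbar_uniq; rewrite mulrDr -scalerAr !dbarE msymD msymZ scalerAr -mulrDr.
by rewrite scalerBr; congr (_ * _); ring.
Qed.

Lemma dbar_symM j f g : s_ j g = g -> pb j (f * g) = pb j f * g.
Proof. by move=> sg; apply: dbar_uniq; rewrite mulrA dbarE msymM sg; ring. Qed.

Lemma dbar_sym0 j f : s_ j f = f -> pb j f = 0.
Proof. by move=> sf; apply: dbar_uniq; rewrite sf subrr !mulr0. Qed.

Lemma dbar_s j f : pb j (s_ j f) = - pb j f.
Proof. by apply: dbar_uniq; rewrite mulrN dbarE msym_sgenK; ring. Qed.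

Lemma msym_dbar j f : (xl j - xh j) * s_ j (pb j f) = xl j * (f - s_ j f).
Proof.
have := congr1 (s_ j) (dbarE j f).
rewrite !msymM !msymB msym_Xlo msym_Xhi msym_sgenK => h.
by rewrite -[LHS]opprK -mulNr opprB h; ring.
Qed.

Lemma dbar_quad j f : pb j (pb j f) + pb j f = 0.
Proof.
apply/eqP; rewrite addr_eq0; apply/eqP/dbar_uniq.
rewrite mulrN dbarE -mulrN; congr (_ * _); apply: (mulfI (subX_lo_hi_neq0 j)).
by rewrite mulrBr dbarE msym_dbar; ring.
Qed.

Lemma msym_dbar_gen j (w : 'S_n) f :
  ('X_(w (lo j)) - 'X_(w (hi j))) * msym w (pb j f) =
  'X_(w (hi j)) * (msym w f - msym (sgen j * w)%g f).
Proof.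
by have := congr1 (msym w) (dbarE j f); rewrite !msymM !msymB !msymXi msymMm.
Qed.

Lemma dbar_comm j k f : (j.+1 < k)%N || (k.+1 < j)%N ->
  pb j (pb k f) = pb k (pb j f).
Proof.
move=> jk; apply: dbar_uniq; apply: (mulfI (subX_lo_hi_neq0 k)).
have e1 : sgen k (lo j) = lo j by apply: sgen_id; rewrite -val_eqE /=; lia.
have e2 : sgen k (hi j) = hi j by apply: sgen_id; rewrite -val_eqE /=; lia.
have e3 : sgen j (lo k) = lo k by apply: sgen_id; rewrite -val_eqE /=; lia.
have e4 : sgen j (hi k) = hi k by apply: sgen_id; rewrite -val_eqE /=; lia.
rewrite mulrCA dbarE.
have := msym_dbar_gen k (sgen j) f; rewrite e3 e4 => h1.
have := msym_dbar_gen j (sgen k) f; rewrite e1 e2 => h2.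
have -> : (xl k - xh k) * (xh j * (pb k f - s_ j (pb k f))) =
  xh j * ((xl k - xh k) * pb k f - (xl k - xh k) * s_ j (pb k f)) by ring.
have -> : (xl j - xh j) * (xh k * (pb j f - s_ k (pb j f))) =
  xh k * ((xl j - xh j) * pb j f - (xl j - xh j) * s_ k (pb j f)) by ring.
rewrite h1 h2 (dbarE k f) (dbarE j f) (sgen_comm jk).
move: (xh j) (xh k) (s_ j f) (s_ k f) (msym (sgen k * sgen j)%g f) => a b u v x.
ring.
Qed.

(* The common value of both sides is x_{i+1} x_{i+2}^2 times the divided
   difference over S_3, i.e. the alternating sum over the Vandermonde. *)
Lemma dbar_braid j k f : k = j.+1 :> nat ->
  pb j (pb k (pb j f)) = pb k (pb j (pb k f)).
Proof.
move=> jk.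
have ek : lo k = hi j by apply/ord_inj.
have e1 : sgen k (lo j) = lo j by apply: sgen_id; rewrite -val_eqE /=; lia.
have e2 : sgen k (hi j) = hi k by rewrite -ek sgen_lo.
have e2' : sgen k (hi k) = hi j by rewrite -ek sgen_hi.
have e3 : sgen j (hi k) = hi k by apply: sgen_id; rewrite -val_eqE /=; lia.
have e4 := sgen_lo j; have e5 := sgen_hi j.
have nab := subX_lo_hi_neq0 j.
have nbc : xh j - xh k != 0 by have := subX_lo_hi_neq0 k; rewrite ek.
have nac : xl j - xh k != 0 by apply: subX_neq0; rewrite -val_eqE /=; lia.
have V0 := mulf_neq0 (mulf_neq0 nab nbc) nac.
have br := sgen_braid jk.
apply: (mulfI V0).
have := msym_dbar_gen j (sgen k) f; rewrite e1 e2 => pt.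
have := msym_dbar_gen j (sgen j) f; rewrite e4 e5 sgenK msym1m => ps.
have := msym_dbar_gen j (sgen k * sgen j)%g f; rewrite !permM e1 e2 e4 e3 mulgA => pts.
have := dbarE k (pb j f); rewrite ek => pk.
have := msym_dbar_gen k (sgen j) (pb j f); rewrite ek e5 e3 => pks.
have E1 := braid_idl nab (dbarE j f) pt ps pts pk pks (dbarE j (pb k (pb j f))).
apply: (etrans E1).
have := dbarE k f; rewrite ek => qk.
have := msym_dbar_gen k (sgen j) f; rewrite ek e5 e3 => qs.
have := msym_dbar_gen k (sgen k) f; rewrite ek e2 e2' sgenK msym1m => qt.
have := msym_dbar_gen k (sgen j * sgen k)%g f; rewrite !permM ek e5 e3 e1 e2' mulgA -br => qst.
have := msym_dbar_gen j (sgen k) (pb k f); rewrite e1 e2 => qjt.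
have := dbarE k (pb j (pb k f)); rewrite ek => qkj.
have E2 := braid_idr nbc qk qs qt qst (dbarE j (pb k f)) qjt qkj.
exact: (esym E2).
Qed.

Definition eq0 (p : P) := p = 0.

Lemma eq0_submod : submod eq0.
Proof. by split=> // c x y -> ->; rewrite scaler0 addr0. Qed.

Lemma dbar_hecke : hecke_module eq0 pb.
Proof.
split; last by move=> j x; apply: dbar_quad.
split=> [|||j k x jk|j k x jk].
- exact: eq0_submod.
- by move=> *; apply: dbar_lin.
- by move=> j x ->; apply: dbar_sym0; rewrite msym0.
- by apply/eqP; rewrite subr_eq0 dbar_comm.
- by apply/eqP; rewrite subr_eq0 dbar_braid.
Qed.

End Demazure.

(** * The filtration of polynomials by the norm of exponents *)

Section NormFiltration.

Local Notation "m # s" := [multinom m (s i) | i < _]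
  (at level 40, left associativity, format "m # s").

Variables (F : fieldType) (n : nat).
Local Notation P := {mpoly F[n]}.
Implicit Types (f g p : P) (m : 'X_{1..n}) (j k : 'I_n.-1) (N : nat).
Local Notation pb := (@demazure_bar F n).

(** Symmetric and strictly convex: constant on orbits of S_n, and smaller strictly inside the
    segment from m to s_j m than at its ends. *)
Definition mnorm m := (\sum_i m i ^ 2)%N.

Lemma mnorm_split m j : mnorm m =
  (m (lo j) ^ 2 + m (hi j) ^ 2 + \sum_(i | (i != lo j) && (i != hi j)) m i ^ 2)%N.
Proof.
rewrite /mnorm (bigD1 (lo j)) //= (bigD1 (hi j)) /= ?addnA //.
by rewrite eq_sym lo_neq_hi.
Qed.

Lemma mnorm_rest m m' j : (forall i, i != lo j -> i != hi j -> m i = m' i) ->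
  (mnorm m + (m' (lo j) ^ 2 + m' (hi j) ^ 2) = mnorm m' + (m (lo j) ^ 2 + m (hi j) ^ 2))%N.
Proof.
move=> h; rewrite (mnorm_split m j) (mnorm_split m' j).
rewrite (eq_bigr (fun i => m' i ^ 2)%N) => [|i /andP[h1 h2]]; last by rewrite h.
move: (\sum_(i | _) _)%N (m (lo j) ^ 2)%N (m (hi j) ^ 2)%N => S a b.
by move: (m' (lo j) ^ 2)%N (m' (hi j) ^ 2)%N => c d; lia.
Qed.

Lemma mnorm_perm m j : mnorm (m#(sgen j)) = mnorm m.
Proof.
have := @mnorm_rest (m#(sgen j)) m j.
rewrite !mnmE sgen_lo sgen_hi => h.
have {}h : (mnorm (m#(sgen j)) + (m (lo j) ^ 2 + m (hi j) ^ 2) =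
            mnorm m + (m (hi j) ^ 2 + m (lo j) ^ 2))%N.
  by apply: h => i h1 h2; rewrite mnmE sgen_id.
move: h; move: (m (lo j) ^ 2)%N (m (hi j) ^ 2)%N (mnorm _) (mnorm _) => a b c d; lia.
Qed.

Lemma mnorm_mshift m j t : (t <= m (lo j))%N ->
  (mnorm (mshift m j t) + (m (lo j) ^ 2 + m (hi j) ^ 2) =
   mnorm m + ((m (lo j) - t) ^ 2 + (m (hi j) + t) ^ 2))%N.
Proof.
move=> le; have := @mnorm_rest (mshift m j t) m j.
rewrite !mnmE eqxx [hi j == lo j]eq_sym (negPf (lo_neq_hi j)) eqxx; apply.
by move=> i /negPf h1 /negPf h2; rewrite mnmE h1 h2.
Qed.

Definition norm_lt N p := forall m, (N <= mnorm m)%N -> mcoeff m p = 0.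

Lemma norm_lt_submod N : submod (norm_lt N).
Proof.
split=> [m _|c x y hx hy m le]; first exact: mcoeff0.
by rewrite mcoeffD mcoeffZ hx // hy // mulr0 addr0.
Qed.

Lemma norm_ltX N m : (mnorm m < N)%N -> norm_lt N 'X_[m].
Proof.
move=> lt m' le; rewrite mcoeffX; case: eqP => // e; move: le lt.
by rewrite e leqNgt => /negPf ->.
Qed.

Lemma norm_lt_ind N (Z : P -> Prop) : submod Z ->
  (forall m, (mnorm m < N)%N -> Z 'X_[m]) -> forall p, norm_lt N p -> Z p.
Proof.
move=> sZ hZ p lp; rewrite [p]mpolyE big_seq; apply: submod_sum => // m.
rewrite mcoeff_msupp => nz; apply: submodZ => //; apply: hZ.
by rewrite ltnNge; apply: contraNN nz => /lp ->.
Qed.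

Lemma dbar_mon m j : (m (hi j) <= m (lo j))%N ->
  pb j 'X_[m] = \sum_(t < m (lo j) - m (hi j)) 'X_[mshift m j t.+1].
Proof.
move=> le; apply: dbar_uniq.
by rewrite mshift_tele ?leq_subr // mperm_sgen // msymX sgenV.
Qed.

Lemma dbar_mon_flip m j : pb j 'X_[m#(sgen j)] = - pb j 'X_[m].
Proof. by rewrite -dbar_s msymX sgenV. Qed.

Lemma mperm2 m j : (m#(sgen j))#(sgen j) = m.
Proof. by apply/mnmP => i; rewrite !mnmE tpermK. Qed.

Lemma dbar_norm_ltX N m j : (mnorm m < N)%N -> norm_lt N (pb j 'X_[m]).
Proof.
have sN := norm_lt_submod N.
wlog le : m / (m (hi j) <= m (lo j))%N.
  move=> wl lt; case: (leqP (m (hi j)) (m (lo j))) => [/wl|gt]; first exact.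
  rewrite -[m](mperm2 _ j) dbar_mon_flip; apply: (submodN sN).
  by apply: wl; rewrite ?mnorm_perm // !mnmE sgen_lo sgen_hi ltnW.
move=> lt; rewrite dbar_mon //; apply: submod_sum => // t _; apply: norm_ltX.
have lt' := ltn_ord t; have := @mnorm_mshift m j t.+1.
by move=> h; have {}h := h (leq_trans lt' (leq_subr _ _)); nia.
Qed.

Lemma dbar_norm_lt N p j : norm_lt N p -> norm_lt N (pb j p).
Proof.
move: p; apply: (@norm_lt_ind N (fun p => norm_lt N (pb j p))) => [|m]; last exact: dbar_norm_ltX.
split=> [|c x y hx hy].
  by rewrite (bm_0 (hm_braid (dbar_hecke F n))); case: (norm_lt_submod N).
by rewrite dbar_lin; apply: (submodDZ (norm_lt_submod N)).
Qed.

Lemma act_norm_lt N u p : norm_lt N p -> norm_lt N (act pb u p).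
Proof. by move=> lp; elim: u => //= j u; apply: dbar_norm_lt. Qed.

(** The last term of the telescoping sum is s_j x^m; all others lie strictly inside the segment. *)
Lemma dbar_lead m j : (m (hi j) < m (lo j))%N ->
  norm_lt (mnorm m) (pb j 'X_[m] - 'X_[m#(sgen j)]).
Proof.
move=> lt; rewrite dbar_mon ?(ltnW lt) //.
have : (0 < m (lo j) - m (hi j))%N by rewrite subn_gt0.
case E : (m (lo j) - m (hi j))%N => [//|d] _.
rewrite big_ord_recr /= -E mperm_sgen ?(ltnW lt) // addrK.
apply: submod_sum => [|t _]; first exact: norm_lt_submod.
have lt' := ltn_ord t; apply: norm_ltX; have := @mnorm_mshift m j t.+1.
by move=> h; have {}h := h ltac:(lia); nia.
Qed.

Lemma dbar_step m j : m (lo j) = (m (hi j)).+1 -> pb j 'X_[m] = 'X_[m#(sgen j)].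
Proof.
move=> e; rewrite dbar_mon ?e // -mperm_sgen ?e // subSnn.
by rewrite big_ord1.
Qed.

End NormFiltration.

(** * Dominant exponents and sliding of subsets *)

Section DominantMonomials.

Variable n : nat.
Implicit Types (m : 'X_{1..n}) (j k : 'I_n.-1) (A : {set 'I_n}) (i p q : 'I_n).

Definition dominant m := forall j, (m (hi j) <= m (lo j))%N.

Lemma hi_lo_succ p : p.+1 = n \/ exists j, p = lo j.
Proof.
have [|ge] := ltnP p n.-1; last by left; have := ltn_ord p; lia.
by move=> lt; right; exists (Ordinal lt); apply/ord_inj.
Qed.

Lemma succ_hi q p : (p < q)%N -> exists2 j, q = hi j & (p <= lo j)%N.
Proof.
move=> pq; have lt : (q.-1 < n.-1)%N by have := ltn_ord q; lia.
by exists (Ordinal lt) => /=; [apply/ord_inj => /=|]; lia.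
Qed.

Lemma dominant_le m p q : dominant m -> (p <= q)%N -> (m q <= m p)%N.
Proof.
move=> dm; move: {2}(q - p)%N (erefl (q - p)%N) => d; elim: d q => [|d IH] q e pq.
  by have -> : q = p by apply/ord_inj; lia.
have [j ej le] : exists2 j, q = hi j & (p <= lo j)%N by apply: succ_hi; lia.
rewrite ej; apply: leq_trans (dm j) (IH _ _ le).
by move: e; rewrite ej /=; lia.
Qed.

Definition initial i : {set 'I_n} := [set p : 'I_n | (p <= i)%N].

(** Without such a gap, A would be closed under predecessors, hence comparable with [initial i] by
    inclusion, and equal cardinalities would make them equal. *)
Lemma not_initial A i : #|A| = #|initial i| -> A <> initial i ->
  exists2 j, lo j \notin A & hi j \in A.
Proof.
move=> cA nA.
have /existsP[j /andP[h1 h2]] : [exists j, (lo j \notin A) && (hi j \in A)];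
  last by exists j.
apply: contra_notT nA; rewrite negb_exists => /forallP h.
have down q : q \in A -> forall p, (p <= q)%N -> p \in A.
  move=> qA p; move: {2}(q - p)%N (erefl (q - p)%N) => d.
  elim: d q qA => [|d IH] q qA e pq.
    by have -> : p = q by apply/ord_inj; lia.
  have [j ej le] : exists2 j, q = hi j & (p <= lo j)%N by apply: succ_hi; lia.
  apply: (IH (lo j)) => //.
    by have := h j; rewrite -ej qA andbT negbK.
  by move: e; rewrite ej /=; lia.
have [iA|iA] := boolP (i \in A).
  apply/eqP; rewrite eq_sym eqEcard cA leqnn andbT; apply/subsetP => p.
  by rewrite inE; apply: down.
apply/eqP; rewrite eqEcard cA leqnn andbT; apply/subsetP => p pA.
rewrite inE leqNgt; apply: contraNN iA => ip; apply: (down p) => //; exact: ltnW.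
Qed.

(** The exponent of x^m times the squarefree monomial of A, that is, of the general term of x^m
    e_k. *)
Definition addA (m : 'X_{1..n}) A : 'X_{1..n} := [multinom (m i + (i \in A))%N | i < n].

(** Fills a gap of A one step to the left. Repeated slides end at the initial segment. Where m is
    flat a slide acts as s_j on [addA m A]; where m drops it raises the norm. *)
Definition slide j A := lo j |: (A :\ hi j).

Lemma in_slide j A p : (p \in slide j A) = (p == lo j) || (p != hi j) && (p \in A).
Proof. by rewrite !inE. Qed.

Lemma card_slide j A : lo j \notin A -> hi j \in A -> #|slide j A| = #|A|.
Proof.
move=> h1 h2; rewrite cardsU1 !inE (negPf h1) andbF /=.
by rewrite (cardsD1 (hi j) A) h2.
Qed.

Lemma sum_slide j A : lo j \notin A -> hi j \in A ->
  (\sum_(p in slide j A) (p : nat) < \sum_(p in A) (p : nat))%N.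
Proof.
move=> h1 h2; rewrite big_setU1 /=; last by rewrite !inE (negPf h1) andbF.
by rewrite [ltnRHS](big_setD1 (hi j)) //= ltn_add2r.
Qed.

Lemma addA_slide m j A : lo j \notin A -> hi j \in A -> m (lo j) = m (hi j) ->
  addA m A = [multinom addA m (slide j A) (sgen j i) | i < n].
Proof.
move=> h1 h2 e; apply/mnmP => p; rewrite !mnmE in_slide.
have [->|n1] := eqVneq p (lo j).
  rewrite sgen_lo eqxx (negPf h1) /= e eq_sym.
  by rewrite (negPf (lo_neq_hi j)).
have [->|n2] := eqVneq p (hi j); first by rewrite sgen_hi eqxx h2 e.
by rewrite sgen_id // (negPf n1) n2.
Qed.

Lemma mnorm_slide m j A : lo j \notin A -> hi j \in A -> (m (hi j) < m (lo j))%N ->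
  (mnorm (addA m A) < mnorm (addA m (slide j A)))%N.
Proof.
move=> h1 h2 lt.
have h : (mnorm (addA m A) + ((m (lo j) + 1) ^ 2 + m (hi j) ^ 2) =
   mnorm (addA m (slide j A)) + (m (lo j) ^ 2 + (m (hi j) + 1) ^ 2))%N.
  have := @mnorm_rest n (addA m A) (addA m (slide j A)) j.
  rewrite !mnmE !in_slide (negPf h1) h2 !eqxx /=.
  rewrite [hi j == _]eq_sym (negPf (lo_neq_hi j)) /= !addn0; apply => p n1 n2.
  by rewrite !mnmE in_slide (negPf n1) n2.
by nia.
Qed.

End DominantMonomials.

(** * The span of the pibar_w x_{D(w)} over the symmetric polynomials *)

Section SymSpan.

Variables (F : fieldType) (n : nat).
Local Notation P := {mpoly F[n]}.
Variable rw : 'S_n -> seq 'I_n.-1.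
Hypothesis hrw : forall w : 'S_n, reduced_word (rw w) w.
Local Notation pb := (@demazure_bar F n).
Local Notation actw := (actw pb rw).
Local Notation len := (@perm_length n).
Implicit Types (p q : P) (w : 'S_n) (j k : 'I_n.-1) (D : {set 'I_n.-1}).

Let hP := dbar_hecke F n.
Let bP := hm_braid hP.

Lemma actw_norm_lt N w p : norm_lt N p -> norm_lt N (actw w p).
Proof. exact: act_norm_lt. Qed.

Definition xD_mnm D : 'X_{1..n} := (\sum_(j in D) \sum_(k : 'I_n | (k <= j)%N) U_(k))%MM.

Lemma xD_mon D : xD F D = 'X_[xD_mnm D].
Proof.
rewrite /xD /xD_mnm (big_morph (fun m => 'X_[m]) (@mpolyXD n F) (@mpolyX0 n F)).
apply: eq_bigr => j _.
by rewrite (big_morph (fun m => 'X_[m]) (@mpolyXD n F) (@mpolyX0 n F)).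
Qed.

Lemma xD_mnmE D i : xD_mnm D i = (\sum_(j in D) (i <= j))%N.
Proof.
rewrite mnm_sumE; apply: eq_bigr => j _; rewrite mnm_sumE.
under eq_bigr do rewrite mnm1E.
rewrite big_mkcond (bigD1 i) //= eqxx big1 ?addn0; first by case: leqP.
by move=> k /negPf ->; rewrite if_same.
Qed.

Lemma xD_mnm_step D j : xD_mnm D (lo j) = (xD_mnm D (hi j) + (j \in D))%N.
Proof.
rewrite !xD_mnmE; have -> : (j \in D : nat) = (\sum_(k in D) (k == j))%N.
  rewrite big_mkcond (bigD1 j) //= eqxx big1 ?addn0; first by case: ifP.
  by move=> k /negPf ->; rewrite if_same.
rewrite -big_split; apply: eq_bigr => k _ /=.
rewrite -val_eqE /=; lia.
Qed.

Lemma dbar_xD D k : k \notin D -> pb k (xD F D) = 0.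
Proof.
move=> kD; apply: dbar_sym0; rewrite xD_mon msymX sgenV; congr mpolyX.
apply/mnmP => i; rewrite mnmE; have e := xD_mnm_step D k; rewrite (negPf kD) addn0 in e.
have [->|n1] := eqVneq i (lo k); first by rewrite sgen_lo.
have [->|n2] := eqVneq i (hi k); first by rewrite sgen_hi.
by rewrite sgen_id.
Qed.

Definition coinv_elt w : P := actw w (xD F (descents w)).

Lemma dbar_coinv_elt j w : pb j (coinv_elt w) = \sum_w' (if descents w' == descents w
  then act_coeff F (descents w) j w w' else 0) *: coinv_elt w'.
Proof.
have h : eq0 (pb j (coinv_elt w) - _) :=
  act_actw hP hrw (@dbar_xD (descents w)) j (erefl (descents w)).
move/eqP: h; rewrite subr_eq0 => /eqP ->.
rewrite big_mkcond; apply: eq_bigr => w' _; case: eqP => [e|_]; last by rewrite scale0r.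
by rewrite /coinv_elt e.
Qed.

Definition symspan p := exists s : 'S_n -> P,
  (forall w, s w \is symmetric) /\ p = \sum_w s w * coinv_elt w.

Lemma symspan_submod : submod symspan.
Proof.
split.
  by exists (fun => 0); split=> [w|]; [apply: rpred0 | rewrite big1 // => w _; rewrite mul0r].
move=> c x y [s [hs ->]] [t [ht ->]]; exists (fun w => c *: s w + t w); split=> [w|].
  by rewrite rpredD ?rpredZ.
rewrite scaler_sumr -big_split; apply: eq_bigr => w _.
by rewrite mulrDl scalerAl.
Qed.

Lemma symspan_mul p q : q \is symmetric -> symspan p -> symspan (p * q).
Proof.
move=> sq [s [hs ->]]; exists (fun w => s w * q); split=> [w|]; first by rewrite rpredM.
by rewrite mulr_suml; apply: eq_bigr => w _; rewrite mulrAC.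
Qed.

Lemma symspan_coinv_elt w : symspan (coinv_elt w).
Proof.
exists (fun v => (v == w)%:R); split=> [v|]; first exact: rpred_nat.
rewrite (bigD1 w) //= eqxx mul1r big1 ?addr0 // => v /negPf ->.
by rewrite mul0r.
Qed.

Lemma dbar_sum (I : Type) (r : seq I) (Q : pred I) (f : I -> P) j :
  pb j (\sum_(i <- r | Q i) f i) = \sum_(i <- r | Q i) pb j (f i).
Proof.
have pbD x y : pb j (x + y) = pb j x + pb j y.
  by have := dbar_lin j 1 x y; rewrite !scale1r.
exact: (big_morph _ pbD (bm_0 bP j)).
Qed.

Lemma symspan_dbar j p : symspan p -> symspan (pb j p).
Proof.
case=> s [hs ->]; rewrite dbar_sum; apply: (submod_sum symspan_submod) => w _.
rewrite mulrC dbar_symM; last by have /issymP -> := hs w.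
apply: symspan_mul => //; rewrite dbar_coinv_elt.
apply: (submod_sum symspan_submod) => w' _; apply: (submodZ symspan_submod).
exact: symspan_coinv_elt.
Qed.

Lemma symspan_act u p : symspan p -> symspan (act pb u p).
Proof. by move=> hp; elim: u => //= j u; apply: symspan_dbar. Qed.

Lemma actw_upE w j p : ~~ (w (hi j) < w (lo j))%N ->
  actw w (pb j p) = actw (sgen j * w)%g p.
Proof. by move=> d; apply/eqP; rewrite -subr_eq0; apply/eqP/(actw_up bP hrw). Qed.

Lemma actw_downE w j p : (w (hi j) < w (lo j))%N ->
  actw w (pb j p) = - actw w p.
Proof. by move=> d; apply/eqP; rewrite -subr_eq0; apply/eqP/(actw_down hP hrw). Qed.

Section ElementaryExpansion.

Variables (m : 'X_{1..n}) (i : 'I_n).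
Hypothesis dm : dominant m.
Let A0 := initial i.
Let N := mnorm (addA m A0).

(** Slide A towards the initial segment. Where m is flat at j, the monomial is pibar_j of the slid
    one, and pibar_w pibar_j is -pibar_w or the operator of a longer element, so lengths stay at
    least [c]. Where m drops, the monomial has norm below [N]. [Z] stands for any subspace of
    polynomials already under control. *)
Lemma slide_weak (A : {set 'I_n}) : #|A| = #|A0| ->
  (mnorm (addA m A) <= N)%N /\
  forall (Z : P -> Prop) c, submod Z -> (forall p, norm_lt N p -> Z p) ->
  (forall w, (c <= len w)%N -> Z (actw w 'X_[addA m A0])) ->
  forall w, (c <= len w)%N -> Z (actw w 'X_[addA m A]).
Proof.
move: {2}(\sum_(p in A) (p : nat))%N (leqnn (\sum_(p in A) (p : nat))%N) => d.
elim: d A => [|d IH] A le cA.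
all: have [->|nA] := eqVneq A A0; first by split.
all: have [j h1 h2] := not_initial cA (elimN eqP nA).
all: have lt := leq_trans (sum_slide h1 h2) le.
  by [].
have [leN HZ] := IH (slide j A) lt (etrans (card_slide h1 h2) cA).
have := dm j; rewrite leq_eqVlt => /orP[/eqP e|gt].
  have eA := addA_slide h1 h2 (esym e).
  split; first by rewrite eA mnorm_perm.
  move=> Z c sZ lZ hZ w cw.
  (* The slid set contains [lo j] but not [hi j] and m is flat there, so the exponents differ by
     exactly one and the telescoping sum has a single term. *)
  have -> : 'X_[addA m A] = pb j 'X_[addA m (slide j A)] :> P.
    rewrite dbar_step -?eA // !mnmE !in_slide eqxx [hi j == _]eq_sym.
    by rewrite (negPf (lo_neq_hi j)) eqxx /= addn0 addn1 e.
  have [d1|d1] := boolP (w (hi j) < w (lo j))%N.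
    by rewrite actw_downE //; apply: (submodN sZ); apply: HZ cw.
  rewrite actw_upE //; apply: (HZ Z c) => //.
  by rewrite len_sgen (negPf d1); apply: leq_trans cw _.
have ltN := leq_trans (mnorm_slide h1 h2 gt) leN.
split=> [|Z c sZ lZ hZ w cw]; first exact: ltnW.
by apply/lZ/actw_norm_lt/norm_ltX.
Qed.

(** A first slide at a flat place happens at a non-descent of w, so it makes w strictly longer;
    [slide_weak] then applies with the bound len w + 1. *)
Lemma slide_strict (A : {set 'I_n}) w (Z : P -> Prop) : #|A| = #|A0| -> A != A0 ->
  (forall j, m (lo j) = m (hi j) -> ~~ (w (hi j) < w (lo j))%N) ->
  submod Z -> (forall p, norm_lt N p -> Z p) ->
  (forall v, (len w < len v)%N -> Z (actw v 'X_[addA m A0])) ->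
  Z (actw w 'X_[addA m A]).
Proof.
move=> cA nA hw sZ lZ hZ.
have [j h1 h2] := not_initial cA (elimN eqP nA).
have [leN HZ] := slide_weak (etrans (card_slide h1 h2) cA).
have := dm j; rewrite leq_eqVlt => /orP[/eqP e|gt]; last first.
  by apply/lZ/actw_norm_lt/norm_ltX/(leq_trans (mnorm_slide h1 h2 gt) leN).
have eA := addA_slide h1 h2 (esym e).
have -> : 'X_[addA m A] = pb j 'X_[addA m (slide j A)] :> P.
  rewrite dbar_step -?eA // !mnmE !in_slide eqxx [hi j == _]eq_sym.
  by rewrite (negPf (lo_neq_hi j)) eqxx /= addn0 addn1 e.
have d1 := hw j (esym e).
rewrite actw_upE //; apply: (HZ Z (len w).+1) => //.
by rewrite len_sgen (negPf d1).
Qed.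

End ElementaryExpansion.

End SymSpan.

(** * Every polynomial lies in the symmetric span *)

Section SymSpanAll.

Variables (F : fieldType) (n : nat).
Local Notation P := {mpoly F[n]}.
Variable rw : 'S_n -> seq 'I_n.-1.
Hypothesis hrw : forall w : 'S_n, reduced_word (rw w) w.
Local Notation pb := (@demazure_bar F n).
Local Notation actw := (actw pb rw).
Local Notation len := (@perm_length n).
Local Notation symspan := (symspan (F := F) rw).
Implicit Types (p q : P) (w : 'S_n) (j k : 'I_n.-1) (D : {set 'I_n.-1}).

Let hP := dbar_hecke F n.
Let bP := hm_braid hP.

Lemma X_mesym (m : 'X_{1..n}) (k : nat) :
  'X_[m] * mesym n F k = \sum_(A : {set 'I_n} | #|A| == k) 'X_[addA m A] :> P.
Proof.
rewrite mesymE mulr_sumr; apply: eq_bigr => A _; rewrite -mpolyXD; congr mpolyX.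
by apply/mnmP => i; rewrite mnmDE !mnmE.
Qed.

Lemma actw_sum w (I : Type) (r : seq I) (Q : pred I) (f : I -> P) :
  actw w (\sum_(i <- r | Q i) f i) = \sum_(i <- r | Q i) actw w (f i).
Proof.
have aD x y : actw w (x + y) = actw w x + actw w y.
  by have := act_lin bP (rw w) 1 x y; rewrite !scale1r.
have a0 : actw w 0 = 0 by have := act_linZ bP (rw w) 0 0; rewrite !scale0r.
exact: (big_morph _ aD a0).
Qed.

Lemma len_le w : (len w <= n * n)%N.
Proof. by apply: leq_trans (max_card _) _; rewrite card_prod !card_ord. Qed.

Lemma mnorm_lt (m m' : 'X_{1..n}) (i : 'I_n) : (forall a, m a <= m' a)%N -> (m i < m' i)%N ->
  (mnorm m < mnorm m')%N.
Proof.
move=> le lt; rewrite /mnorm (bigD1 i) // [ltnRHS](bigD1 i) //= -addSn.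
by rewrite leq_add ?ltn_exp2r // leq_sum // => p _; rewrite leq_exp2r.
Qed.

(* Three cases: a descent j of w with m_j = m_(j+1) kills x^m; a column of height i
   in excess of the descents of w is split off using e_i; otherwise x^m = x_{D(w)}. *)
Lemma symspan_dominant_step (m : 'X_{1..n}) w : dominant m ->
  (forall m' : 'X_{1..n}, (mnorm m' < mnorm m)%N -> symspan 'X_[m']) ->
  (forall v, (len w < len v)%N -> symspan (actw v 'X_[m])) ->
  symspan (actw w 'X_[m]).
Proof.
move=> dm IHm IHw.
have sQ := symspan_submod F rw.
have lowQ p : norm_lt (mnorm m) p -> symspan p by apply: norm_lt_ind.
have [/existsP[j /andP[dj /eqP ej]]|/existsPn nkill] :=
  boolP [exists j, (w (hi j) < w (lo j))%N && (m (lo j) == m (hi j))].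
  suff -> : actw w 'X_[m] = 0 by apply: submod0 sQ.
  apply: (actw_kill bP hrw dj); apply: dbar_sym0.
  rewrite msymX sgenV; congr mpolyX; apply/mnmP => i; rewrite mnmE.
  have [->|n1] := eqVneq i (lo j); first by rewrite sgen_lo.
  have [->|n2] := eqVneq i (hi j); first by rewrite sgen_hi.
  by rewrite sgen_id.
(* Positions are 0-based, so the column at [i] has height i + 1. At the last position the
   implication is vacuous: a full column is never forced by a descent. *)
have [/existsP[i /andP[mi0 /forallP hi_]]|/existsPn nsplit] :=
  boolP [exists i : 'I_n, (0 < m i)%N && [forall j, (i == lo j) ==>
    (m (hi j) + (w (hi j) < w (lo j)) < m (lo j))%N]].
  have mpos (a : 'I_n) : (a <= i)%N -> (0 < m a)%N.
    by move=> ai; apply: leq_trans mi0 (dominant_le dm ai).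
  pose mu : 'X_{1..n} := [multinom (m a - (a <= i)%N)%N | a < n].
  have muA : addA mu (initial i) = m.
    apply/mnmP => p; rewrite !mnmE inE; case: leqP => [/mpos|_]; last by lia.
    by move=> ?; rewrite subnK.
  have dmu : dominant mu.
    move=> j; rewrite !mnmE; have := dm j; have := hi_ j.
    have := implyP (hi_ j); rewrite -val_eqE /= => /= h1 _ h2.
    case: (leqP j i) => [ji|]; last by lia.
    have [ij|ij] := eqVneq (i : nat) j; first by have := h1 (introT eqP ij); lia.
    by lia.
  (* If mu is flat at j, then either m is flat there too, which [nkill] excludes at a descent, or j
     = i and m drops by exactly one, which the excess at i excludes at a descent. *)
  have hmu j : mu (lo j) = mu (hi j) -> ~~ (w (hi j) < w (lo j))%N.
    rewrite !mnmE /= => e; have := nkill j; have := implyP (hi_ j).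
    rewrite -val_eqE /=; have := mpos (lo j); have := mpos (hi j) => /=.
    have := dm j.
    case: (w (hi j) < w (lo j))%N => //= h1 h2 h3 h4.
    have [ij|ij] := eqVneq (i : nat) j; first by have := h4 (introT eqP ij); lia.
    by lia.
  have ltmu : (mnorm mu < mnorm m)%N.
    apply: (@mnorm_lt _ _ i) => [p|]; first by rewrite mnmE leq_subr.
    by rewrite mnmE leqnn; lia.
  have h : symspan (actw w ('X_[mu] * mesym n F #|initial i|)).
    by apply: (symspan_act hrw); apply: symspan_mul; [apply: mesym_sym | apply: IHm].
  rewrite X_mesym actw_sum (bigD1 (initial i)) //= muA in h.
  set R := (X in symspan (_ + X)) in h.
  have hR : symspan R.
    apply: (submod_sum sQ) => A /andP[/eqP cA nA].
    by apply: (slide_strict hrw dmu (i := i)) => //; rewrite muA.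
  by rewrite -(addrK R (actw w _)); apply: (submodB sQ).
have -> : 'X_[m] = xD F (descents w) :> P; last exact: symspan_coinv_elt.
rewrite xD_mon; congr mpolyX; apply/mnmP => i.
(* Recursion from the last position, where both exponents are 0: the remaining conditions force m to
   drop by 1 at the descents of w and by 0 elsewhere, just as [xD_mnm] does. *)
move: {2}(n - i)%N (leqnn (n - i)%N) => d; elim: d i => [|d IHd] i le.
  by have := ltn_ord i; lia.
have := nsplit i; case: (hi_lo_succ i) => [il|[j ij]].
  have -> : xD_mnm (descents w) i = 0%N.
    rewrite xD_mnmE big1 // => j _; have := ltn_ord j; rewrite leqNgt.
    by case: ltnP => //; lia.
  case: (posnP (m i)) => [-> //|mi] /=.
  case/negP; apply/forallP => j; apply/implyP => /eqP ij.
  by have := ltn_ord (hi j); rewrite /= -[j : nat]/(lo j : nat) -ij il ltnn.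
rewrite negb_and -leqNgt leqn0 => h.
have IH := IHd (hi j); rewrite {}ij in le h *.
rewrite xD_mnm_step in_descents -IH; last by move: le => /=; lia.
have := dm j; have := nkill j.
case/orP: h => [/eqP ->|].
  rewrite leqn0 => nk /eqP m0; move: nk; rewrite m0.
  by case: (w (hi j) < w (lo j))%N.
move=> /forallPn[k]; rewrite negb_imply -leqNgt => /andP[/eqP e].
have -> : k = j by apply/ord_inj; have := congr1 (@nat_of_ord n) e.
by rewrite negb_and; case: (w (hi j) < w (lo j))%N => /=; lia.
Qed.

Lemma symspan_dominant (m : 'X_{1..n}) w : dominant m ->
  (forall m' : 'X_{1..n}, (mnorm m' < mnorm m)%N -> symspan 'X_[m']) ->
  symspan (actw w 'X_[m]).
Proof.
move=> dm IHm.
(* Downward induction on the length of w, with the crude bound n * n of [len_le]. *)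
move: {2}(n * n - len w)%N (leqnn (n * n - len w)%N) => d.
elim: d w => [|d IHd] w le; apply: symspan_dominant_step => // v lt.
  by have := len_le v; lia.
by apply: IHd; have := len_le v; lia.
Qed.

Lemma actw1 p : actw 1%g p = p.
Proof.
have /reducedP[_] := hrw 1%g; rewrite len1 => /size0nil e.
by rewrite -[actw _ _]/(act pb (rw 1%g) p) e.
Qed.

Lemma weight_sgen (m : 'X_{1..n}) j : (m (lo j) < m (hi j))%N ->
  (\sum_(i < n) i * m (sgen j i) < \sum_(i < n) i * m i)%N.
Proof.
move=> lt; have nlh := lo_neq_hi j.
have split (f : 'I_n -> nat) : (\sum_(i < n) i * f i =
    lo j * f (lo j) + hi j * f (hi j) + \sum_(i | (i != lo j) && (i != hi j)) i * f i)%N.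
  by rewrite (bigD1 (lo j)) // (bigD1 (hi j)) /= ?addnA // eq_sym.
rewrite !split sgen_lo sgen_hi.
rewrite [X in (_ + X < _)%N](eq_bigr (fun i : 'I_n => i * m i)%N); last first.
  by move=> i /andP[n1 n2]; rewrite sgen_id.
by rewrite ltn_add2r /=; nia.
Qed.

(** Outer induction on the norm, inner induction on the weight sum_i i m_i. If m ascends at j, then
    x^m is the leading term of pibar_j x^{m'} with m' = s_j m, which has the same norm and smaller
    weight. *)
Lemma symspan_X (m : 'X_{1..n}) : symspan 'X_[m].
Proof.
have sQ := symspan_submod F rw.
move: {2}(mnorm m).+1 (ltnSn (mnorm m)) => N; elim: N m => // N IHN m leN.
have low_m p : norm_lt (mnorm m) p -> symspan p.
  by apply: norm_lt_ind => // m' lt; apply: IHN; lia.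
move: {2}(\sum_(i < n) i * m i).+1%N (ltnSn (\sum_(i < n) i * m i)%N) => d.
elim: d m leN low_m => // d IHd m leN low_m le.
have [/forallP dm|/forallPn[j]] := boolP [forall j, m (hi j) <= m (lo j)]%N.
  rewrite -[X in symspan X]actw1; apply: symspan_dominant => // m' lt.
  by apply: IHN; lia.
rewrite -ltnNge => ltj.
pose m' : 'X_{1..n} := [multinom m (sgen j i) | i < n].
have nm' : mnorm m' = mnorm m by rewrite mnorm_perm.
have hm' : symspan 'X_[m'].
  apply: IHd; rewrite ?nm' //; apply: leq_trans (leq_trans _ (weight_sgen ltj)) le.
  by rewrite ltnS; under eq_bigr do rewrite mnmE.
have lead : norm_lt (mnorm m') (pb j 'X_[m'] - 'X_[m]).
  have e : [multinom m' (sgen j i) | i < n] = m.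
    by apply/mnmP => i; rewrite !mnmE tpermK.
  have -> : 'X_[m] = 'X_[[multinom m' (sgen j i) | i < n]] :> P by rewrite e.
  by apply: dbar_lead; rewrite !mnmE sgen_lo sgen_hi.
rewrite nm' in lead.
apply: (submod_eq_in sQ (submod_sym sQ (low_m _ lead))).
exact: (symspan_dbar hrw).
Qed.

Lemma symspan_all p : symspan p.
Proof.
rewrite [p]mpolyE; apply: (submod_sum (symspan_submod F rw)) => m _.
by apply: (submodZ (symspan_submod F rw)); apply: symspan_X.
Qed.

End SymSpanAll.

(** * The basis of the coinvariant algebra *)

Section CoinvariantBasis.

Variables (F : fieldType) (n : nat).
Local Notation P := {mpoly F[n]}.
Variable rw : 'S_n -> seq 'I_n.-1.
Hypothesis hrw : forall w : 'S_n, reduced_word (rw w) w.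
Local Notation pb := (@demazure_bar F n).
Local Notation coinv_elt := (coinv_elt F rw).
Local Notation symspan := (symspan (F := F) rw).
Implicit Types (p q : P) (w v : 'S_n) (j k : 'I_n.-1) (D : {set 'I_n.-1}).
Local Notation W := (@coinv_ideal F n).

Lemma coinv_gen p q : sym_plus q -> W (p * q).
Proof.
move=> hq; exists [:: (p, q)]; split; last by rewrite big_seq1.
by move=> t; rewrite inE => /eqP ->.
Qed.

Lemma coinv_submod : submod W.
Proof.
split; first by exists [::]; split=> //; rewrite big_nil.
move=> c x y [l [hl ->]] [l' [hl' ->]].
exists ([seq (c *: t.1, t.2) | t <- l] ++ l'); split=> [t|].
  by rewrite mem_cat => /orP[/mapP[t' /hl ? ->]|/hl'].
rewrite big_cat big_map scaler_sumr /=; congr (_ + _).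
by apply: eq_bigr => t _; rewrite scalerAl.
Qed.

Lemma coinv_ind (Z : P -> Prop) : submod Z ->
  (forall p q, sym_plus q -> Z (p * q)) -> forall p, W p -> Z p.
Proof.
move=> sZ hZ p [l [hl ->]]; rewrite big_seq; apply: (submod_sum sZ) => t /hl.
exact: hZ.
Qed.

Lemma coinv_dbar j p : W p -> W (pb j p).
Proof.
move: p; apply: (@coinv_ind (fun p => W (pb j p))) => [|p q hq].
  split=> [|c x y hx hy].
    by rewrite (bm_0 (hm_braid (dbar_hecke F n))); case: coinv_submod.
  by rewrite dbar_lin; apply: (submodDZ coinv_submod).
by have /andP[/issymP sq _] := hq; rewrite dbar_symM //; apply: coinv_gen.
Qed.

Lemma coinv_hecke : hecke_module W pb.
Proof.
have W0 : W 0 by case: coinv_submod.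
have [[_ hl _ hc hb] hq] := dbar_hecke F n.
split; last by move=> j x; rewrite (hq j x).
split=> //; first exact: coinv_submod.
- by move=> j x; apply: coinv_dbar.
- by move=> j k x jk; rewrite (hc j k x jk).
by move=> j k x jk; rewrite (hb j k x jk).
Qed.

(* Dedekind independence of the automorphisms of F[x] given by S_n. *)
Lemma msym_free (r : seq 'S_n) (a : 'S_n -> P) : uniq r ->
  (forall f : P, \sum_(v <- r) a v * msym v f = 0) -> forall v, v \in r -> a v = 0.
Proof.
elim: r a => // u r IH a /= /andP[ur /IH {}IH] h.
have ar v : v \in r -> a v = 0.
  move=> vr; have uv : u != v by apply: contraNneq ur => ->.
  have /existsP[i hi] : [exists i, v i != u i].
    apply: contraNT uv; rewrite negb_exists => /forallP e.
    by apply/eqP/permP => i; have := e i; rewrite negbK => /eqP.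
  (* Testing on x_i f and subtracting x_{u(i)} times the relation for f removes the term of u and
     multiplies that of v by a factor nonzero for the chosen v. *)
  have h' f : \sum_(v <- r) a v * ('X_(v i) - 'X_(u i)) * msym v f = 0.
    have := h ('X_i * f); have := h f; rewrite !big_cons msymM msymXi => /eqP.
    rewrite addrC addr_eq0 => /eqP e1 /eqP; rewrite addrC addr_eq0 => /eqP e2.
    transitivity (\sum_(v <- r) a v * msym v ('X_i * f)
                  - 'X_(u i) * \sum_(v <- r) a v * msym v f).
      rewrite mulr_sumr -sumrB; apply: eq_bigr => x _.
      by rewrite msymM msymXi; ring.
    by rewrite e1 e2; ring.
  have /eqP := IH (fun v => a v * ('X_(v i) - 'X_(u i))) h' v vr.
  by rewrite mulf_eq0 (negPf (subX_neq0 F hi)) orbF => /eqP.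
move=> v; rewrite inE => /orP[/eqP ->|]; last exact: ar.
have := h 1; rewrite big_cons big_seq big1 ?addr0; last first.
  by move=> x /ar ->; rewrite mul0r.
by rewrite msym1 mulr1.
Qed.

Lemma coinv_elt_symfree (s : 'S_n -> P) : (forall w, s w \is symmetric) ->
  \sum_w s w * coinv_elt w = 0 -> forall w, s w = 0.
Proof.
move=> hs s0.
pose B : 'M[P]_(#|{: 'S_n}|) := \matrix_(u, w) msym (enum_val u) (coinv_elt (enum_val w)).
have sumE (f : 'S_n -> P) : \sum_w f w = \sum_(i < #|{: 'S_n}|) f (enum_val i).
  by rewrite (reindex (@enum_val 'S_n predT)) //=; apply: onW_bij (enum_val_bij _).
(* A row [v] with [v *m B = 0] is a relation between the automorphisms on all the pibar_w x_{D(w)}.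
   These span over the symmetric polynomials, which the automorphisms fix, so the relation holds on
   all of F[x]. *)
have detB : \det B != 0.
  apply/negP => /det0P[v nv vB]; case/negP: nv; apply/eqP/rowP => i; rewrite mxE.
  rewrite -[i](enum_valK) -[LHS]/((fun u => v 0 (enum_rank u)) (enum_val i)).
  apply: (@msym_free (index_enum _)); rewrite ?index_enum_uniq ?mem_index_enum // => f.
  have [t [ht ->]] := symspan_all hrw f.
  under eq_bigr do rewrite linear_sum mulr_sumr.
  rewrite exchange_big big1 // => w _.
  transitivity (t w * (v *m B) 0 (enum_rank w)); last by rewrite vB mxE mulr0.
  rewrite mxE sumE mulr_sumr; apply: eq_bigr => u _ /=.
  have /issymP hw := ht w.
  by rewrite !mxE /= enum_valK enum_rankK msymM hw; ring.
(* Every permutation fixes the symmetric coefficients, so applying all of them to the one relation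
   gives a linear system with matrix B. The entries lie in a domain, hence the adjugate below. *)
have Bs : B *m (\col_i s (enum_val i)) = 0.
  apply/colP => u; transitivity (msym (enum_val u) (\sum_w s w * coinv_elt w)); last first.
    by rewrite s0 msym0 mxE.
  rewrite mxE linear_sum sumE.
  apply: eq_bigr => w _ /=; have /issymP hw := hs (enum_val w).
  by rewrite !mxE msymM hw mulrC.
have : \adj B *m (B *m (\col_i s (enum_val i))) = 0 by rewrite Bs mulmx0.
rewrite mulmxA mul_adj_mx mul_scalar_mx => /colP h w.
have /eqP := h (enum_rank w); rewrite !mxE enum_rankK mulf_eq0 (negPf detB) /=.
by move/eqP.
Qed.

(** Expand the first factor of p q in the symmetric span and absorb q into the coefficients: they
    then have no constant term. *)
Lemma coinv_symspan p : W p -> exists s : 'S_n -> P,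
  (forall w, sym_plus (s w)) /\ p = \sum_w s w * coinv_elt w.
Proof.
move: p; apply: coinv_ind => [|p q hq].
  split.
    exists (fun => 0); rewrite big1 => [|w _]; last by rewrite mul0r.
    by split=> // w; rewrite /sym_plus rpred0 mcoeff0 eqxx.
  move=> c x y [s [hs ->]] [t [ht ->]]; exists (fun w => c *: s w + t w); split=> [w|].
    have /andP[s1 /eqP s2] := hs w; have /andP[t1 /eqP t2] := ht w.
    by rewrite /sym_plus rpredD ?rpredZ //= mcoeffD mcoeffZ s2 t2 mulr0 addr0 eqxx.
  rewrite scaler_sumr -big_split; apply: eq_bigr => w _.
  by rewrite mulrDl scalerAl.
have [s [hs ->]] := symspan_all hrw p; exists (fun w => s w * q).
have /andP[q1 /eqP q2] := hq; split=> [w|].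
  rewrite /sym_plus rpredM //=.
  have -> : mcoeff 0%MM (s w * q) = mcoeff 0%MM (s w) * mcoeff 0%MM q.
    exact: (rmorphM (mcoeff 0%MM)).
  by rewrite q2 mulr0 eqxx.
by rewrite mulr_suml; apply: eq_bigr => w _; rewrite mulrAC.
Qed.

(** Comparison with the previous expansion forces [c w] to equal a symmetric polynomial without
    constant term. *)
Lemma coinv_elt_free (c : 'S_n -> F) : W (\sum_w c w *: coinv_elt w) -> forall w, c w = 0.
Proof.
move=> /coinv_symspan[s [hs e]] w.
have h : \sum_w (c w *: 1 - s w) * coinv_elt w = 0.
  rewrite -[RHS](subrr (\sum_w c w *: coinv_elt w)) [X in _ = _ - X]e -sumrB.
  by apply: eq_bigr => v _; rewrite mulrBl -scalerAl mul1r.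
have /eqP : c w *: 1 - s w = 0.
  apply: (coinv_elt_symfree _ h) => v; have /andP[h1 _] := hs v.
  by rewrite rpredB ?rpredZ ?rpred1.
rewrite subr_eq0 => /eqP /(congr1 (mcoeff 0%MM)).
by rewrite mcoeffZ mcoeff1 eqxx mulr1 => ->; have /andP[_ /eqP] := hs w.
Qed.

(** A symmetric coefficient is congruent to its constant term modulo the ideal. *)
Lemma coinv_elt_span p : qspan W predT coinv_elt p.
Proof.
have [s [hs ->]] := symspan_all hrw p.
exists (fun w => mcoeff 0%MM (s w)); rewrite -sumrB.
apply: (submod_sum coinv_submod) => w _.
rewrite -[mcoeff _ _ *: coinv_elt w]mulr_algl -mulrBl mulrC; apply: coinv_gen.
rewrite /sym_plus rpredB ?rpredZ ?rpred1 //= mcoeffB mcoeffZ mcoeff1 eqxx mulr1 subrr.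
by rewrite eqxx.
Qed.

End CoinvariantBasis.

(** * Noncommutative identities for the Hecke relators *)

Section RingIdentities.

Variables (R : nzRingType).
Implicit Types (x y a : R).

Lemma comm_factor x y a : x * (y * a) - y * (x * a) = (x * y - y * x) * a.
Proof. by rewrite mulrBl !mulrA. Qed.

Lemma braid_factor x y a :
  x * (y * (x * a)) - y * (x * (y * a)) = (x * y * x - y * x * y) * a.
Proof. by rewrite mulrBl !mulrA. Qed.

Lemma quad_factor x a : x * (x * a) + x * a = (x * x + x) * a.
Proof. by rewrite mulrDl mulrA. Qed.

Lemma comm_shift x y : (x + 1) * (y + 1) - (y + 1) * (x + 1) = x * y - y * x.
Proof.
have e u v : (u + 1) * (v + 1) = u * v + (u + v + 1) :> R.
  by rewrite mulrDl mul1r mulrDr mulr1 !addrA.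
by rewrite !e [y + x]addrC opprD addrACA subrr addr0.
Qed.

(** The braid relator of x+1, y+1 is that of x, y corrected by the two quadratic relators; hence the
    T'_j satisfy the braid relations modulo the Hecke ideal. *)
Lemma braid_shift x y : (x + 1) * (y + 1) * (x + 1) - (y + 1) * (x + 1) * (y + 1) =
  (x * y * x - y * x * y) + (x * x + x) - (y * y + y).
Proof.
pose s x y : R := x * y + y * x + (x + y + 1).
have e u v : (u + 1) * (v + 1) * (u + 1) = u * v * u + (u * u + u) + s u v.
  have -> : (u + 1) * (v + 1) = u * v + (u + v + 1).
    by rewrite mulrDl mul1r mulrDr mulr1 !addrA.
  have -> : (u * v + (u + v + 1)) * (u + 1) =
    u * v * u + (u * u + v * u + u) + (u * v + (u + v + 1)).
    by rewrite mulrDr mulr1 mulrDl (mulrDl _ 1) mulrDl mul1r.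
  rewrite /s -!addrA; congr (_ + (_ + _)).
  by rewrite [LHS]addrCA; congr (_ + _); apply: addrCA.
have -> : (y + 1) * (x + 1) * (y + 1) = y * x * y + (y * y + y) + s x y.
  by rewrite e /s [y + x]addrC [y * x + _]addrC.
by rewrite e opprD addrACA subrr addr0 opprD addrACA -!addrA.
Qed.

Lemma comm_shift_factor x y a :
  (x + 1) * ((y + 1) * a) - (y + 1) * ((x + 1) * a) = (x * y - y * x) * a.
Proof. by rewrite comm_factor comm_shift. Qed.

Lemma braid_shift_factor x y a :
  (x + 1) * ((y + 1) * ((x + 1) * a)) - (y + 1) * ((x + 1) * ((y + 1) * a)) =
  ((x * y * x - y * x * y) + (x * x + x) - (y * y + y)) * a.
Proof. by rewrite braid_factor braid_shift. Qed.

End RingIdentities.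

(** * The 0-Hecke algebra as a quotient of the free algebra, and its action on polynomials *)

Section HeckeAlgebra.

Variables (F : fieldType) (n : nat).
Local Notation A := (FA F n).
Local Notation P := {mpoly F[n]}.
Local Notation hid := (@hecke_ideal F n).
Local Notation T := (@Tgen F n).
Local Notation Tw := (@Tword F n).
Local Notation lmul := (@hecke_lmul F n).
Local Notation pb := (@demazure_bar F n).
Implicit Types (a b : A) (f g : P) (c : F) (j k : 'I_n.-1) (u v : seq 'I_n.-1).

Lemma malgZU c x (k : {fmonom 'I_n.-1}) :
  c *: (monalg.mkmalgU k x : A) = monalg.mkmalgU k (c * x).
Proof.
apply/malgP => k'; rewrite (monalg.mcoeffZ c _ k') (monalg.mcoeffU k x) (monalg.mcoeffU k (c * x)).
exact: mulrnAr.
Qed.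

Lemma FA_scalerAr c a b : a * (c *: b) = c *: (a * b).
Proof.
have le := monalg.msuppZ_le c b.
rewrite !malgM_def (fgmulrw (finmap.fsubset_refl _) le) fgmulr scaler_sumr.
apply: eq_bigr => k2 _; rewrite scaler_sumr; apply: eq_bigr => k1 _.
by rewrite malgZU monalg.mcoeffZ mulrCA.
Qed.

Lemma Tword_cat u v : Tw (u ++ v) = Tw u * Tw v.
Proof. by rewrite /Tword big_cat. Qed.

Lemma Tword_cons j u : Tw (j :: u) = T j * Tw u.
Proof. by rewrite /Tword big_cons. Qed.

Lemma Tword_mkmalgU (k : {fmonom 'I_n.-1}) : Tw (fmonom_val k) = monalg.mkmalgU k 1.
Proof.
rewrite -[k in RHS]fmK; elim: (fmonom_val k) => [|j u IH].
  by rewrite /Tword big_nil -fmoneE.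
rewrite Tword_cons IH malgM_def fgmulUU mulr1; congr monalg.mkmalgU.
by apply/eqP; rewrite fmP fmM fmU.
Qed.

Lemma FA_ind (Z : A -> Prop) : submod Z -> (forall u, Z (Tw u)) -> forall a, Z a.
Proof.
move=> sZ hZ a; rewrite [a]monalg.monalgE; apply: (submod_sum sZ) => k _.
rewrite -[monalg.mcoeff k a]mulr1 -malgZU -Tword_mkmalgU.
exact: (submodZ sZ).
Qed.

Lemma hecke_ideal_submod : submod hid.
Proof.
split; first by exists [::]; split=> //; rewrite big_nil.
move=> c x y [l [hl ->]] [l' [hl' ->]].
exists ([seq (c *: t.1.1, t.1.2, t.2) | t <- l] ++ l'); split=> [t|].
  by rewrite mem_cat => /orP[/mapP[t' /hl ? ->]|/hl'].
rewrite big_cat big_map scaler_sumr /=; congr (_ + _).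
by apply: eq_bigr => t _; rewrite 2!scalerAl.
Qed.

Lemma hecke_ideal_mull a b : hid b -> hid (a * b).
Proof.
move=> [l [hl ->]]; exists [seq (a * t.1.1, t.1.2, t.2) | t <- l]; split=> [t|].
  by case/mapP => t' /hl ? ->.
by rewrite big_map mulr_sumr; apply: eq_bigr => t _ /=; rewrite 2!mulrA.
Qed.

Lemma hecke_ideal_mulr a b : hid a -> hid (a * b).
Proof.
move=> [l [hl ->]]; exists [seq (t.1.1, t.1.2, t.2 * b) | t <- l]; split=> [t|].
  by case/mapP => t' /hl ? ->.
by rewrite big_map mulr_suml; apply: eq_bigr => t _ /=; rewrite [RHS]mulrA.
Qed.

Lemma hecke_ideal_rel a : hecke_rel a -> hid a.
Proof.
move=> ha; exists [:: (1, a, 1)]; split; last by rewrite big_seq1 mul1r mulr1.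
by move=> t; rewrite inE => /eqP ->.
Qed.

Lemma hecke_ideal_quad j : hid (T j * T j + T j).
Proof. by apply: hecke_ideal_rel; constructor 1; exists j. Qed.

Lemma hecke_ideal_comm j k : (j.+1 < k)%N || (k.+1 < j)%N -> hid (T j * T k - T k * T j).
Proof. by move=> jk; apply: hecke_ideal_rel; constructor 3; exists j, k. Qed.

Lemma hecke_ideal_braid j k : k = j.+1 :> nat -> hid (T j * T k * T j - T k * T j * T k).
Proof. by move=> jk; apply: hecke_ideal_rel; constructor 2; exists j, k. Qed.

Lemma lmul_hecke : hecke_module hid lmul.
Proof.
split; last first.
  move=> j a; have /= e := quad_factor (T j) a.
  by rewrite /hecke_lmul e; apply/hecke_ideal_mulr/hecke_ideal_quad.
split.
- exact: hecke_ideal_submod.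
- by move=> j c a b; rewrite /hecke_lmul mulrDr FA_scalerAr.
- by move=> j a; apply: hecke_ideal_mull.
- move=> j k a jk; have e := comm_factor (T j) (T k) a.
  by rewrite /hecke_lmul e; apply/hecke_ideal_mulr/hecke_ideal_comm.
move=> j k a jk; have e := braid_factor (T j) (T k) a.
by rewrite /hecke_lmul e; apply/hecke_ideal_mulr/hecke_ideal_braid.
Qed.

Definition lmul' j a : A := (T j + 1) * a.

(** T'_j is idempotent, so its quadratic relation is not that of a [hecke_module]; the braid
    relations suffice to make T'_w independent of the reduced word. *)
Lemma lmul'_braid : braid_module hid lmul'.
Proof.
split.
- exact: hecke_ideal_submod.
- by move=> j c a b; rewrite /lmul' mulrDr FA_scalerAr.
- by move=> j a; apply: hecke_ideal_mull.
- move=> j k a jk; have e := comm_shift_factor (T j) (T k) a.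
  by rewrite /lmul' e; apply/hecke_ideal_mulr/hecke_ideal_comm.
move=> j k a jk; have e := braid_shift_factor (T j) (T k) a.
rewrite /lmul' e; apply: hecke_ideal_mulr.
apply: (submodB hecke_ideal_submod); last exact: hecke_ideal_quad.
by apply: (submodD hecke_ideal_submod); [apply: hecke_ideal_braid | apply: hecke_ideal_quad].
Qed.

Lemma act_lmul u a : act lmul u a = Tw u * a.
Proof.
elim: u => [|j u IH] /=; first by rewrite /Tword big_nil mul1r.
by rewrite /hecke_lmul IH Tword_cons; apply: mulrA.
Qed.

Lemma act_lmul' u a : act lmul' u a = T'word F u * a.
Proof.
elim: u => [|j u IH] /=; first by rewrite /T'word big_nil mul1r.
by rewrite /lmul' IH /T'word big_cons; apply: mulrA.
Qed.

Lemma hecke_act_lin c a b f :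
  hecke_act (c *: a + b) f = c *: hecke_act a f + hecke_act b f.
Proof.
(* The three supports differ, so each sum is first extended by zeros to a common finite set. *)
have ext (d : finmap.finset_of (Phant {fmonom 'I_n.-1})) x :
    is_true (finmap.fsubset (monalg.msupp x) d) -> hecke_act x f =
    \sum_(u <- finmap.enum_fset d) monalg.mcoeff u x *: pibar_word (fmonom_val u) f.
  move=> le; rewrite [LHS](finmap.big_fset_incl _ le) => //= u _ ud.
  by rewrite mcoeff_outdom // scale0r.
pose d := finmap.fsetU (monalg.msupp (c *: a + b))
  (finmap.fsetU (monalg.msupp a) (monalg.msupp b)).
rewrite !(ext d).
- rewrite scaler_sumr -big_split; apply: eq_bigr => u _ /=.
  by rewrite monalg.mcoeffD monalg.mcoeffZ scalerDl scalerA.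
- exact: finmap.fsubset_trans (finmap.fsubsetUr _ _) (finmap.fsubsetUr _ _).
- exact: finmap.fsubset_trans (finmap.fsubsetUl _ _) (finmap.fsubsetUr _ _).
exact: finmap.fsubsetUl.
Qed.

Lemma hecke_act0 f : hecke_act (0 : A) f = 0.
Proof. by have := hecke_act_lin (-1) 0 0 f; rewrite scaler0 addr0 scaleN1r addNr. Qed.

Lemma hecke_act_Tword u f : hecke_act (Tw u) f = pibar_word u f.
Proof.
have e := Tword_mkmalgU (FMonom u).
rewrite -[u]/(fmonom_val (FMonom u)) e /hecke_act monalg.msuppU oner_eq0.
by rewrite finmap.big_seq_fset1 monalg.mcoeffUU scale1r.
Qed.

Lemma dbar_hecke_act u a f : hecke_act (Tw u * a) f = pibar_word u (hecke_act a f).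
Proof.
have bP := hm_braid (dbar_hecke F n).
move: a; apply: FA_ind => [|v].
  split.
    rewrite mulr0 hecke_act0 -[pibar_word u]/(act pb u) -(scale0r 0).
    by rewrite (act_linZ bP) !scale0r.
  move=> c a b ha hb.
  rewrite (mulrDr (Tw u) (c *: a) b) (FA_scalerAr c (Tw u) a).
  apply: (etrans (hecke_act_lin c (Tw u * a) (Tw u * b) f)).
  apply: (etrans (congr2 (fun x y => c *: x + y) ha hb)).
  by rewrite (hecke_act_lin c a b f); apply: (esym (act_lin bP u c _ _)).
rewrite -Tword_cat !hecke_act_Tword; exact: foldr_cat.
Qed.

Lemma hecke_actM a b f : hecke_act (a * b) f = hecke_act a (hecke_act b f).
Proof.
move: a; apply: FA_ind => [|u]; last by rewrite dbar_hecke_act hecke_act_Tword.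
split; first by rewrite mul0r !hecke_act0.
move=> c x y hx hy.
rewrite (mulrDl (c *: x) y b) -(scalerAl c x b).
apply: (etrans (hecke_act_lin c (x * b) (y * b) f)).
apply: (etrans (congr2 (fun x y => c *: x + y) hx hy)).
exact: esym (hecke_act_lin c x y (hecke_act b f)).
Qed.

(** The action of the free algebra descends to H_n(0): each relator acts by zero because the pibar_j
    satisfy the same relation. *)
Lemma hecke_act_hid a f : hid a -> hecke_act a f = 0.
Proof.
have actB (x y : A) g : hecke_act (x - y) g = hecke_act x g - hecke_act y g.
  by rewrite addrC -scaleN1r hecke_act_lin scaleN1r addrC.
have actD (x y : A) g : hecke_act (x + y) g = hecke_act x g + hecke_act y g.
  by have := hecke_act_lin 1 x y g; rewrite !scale1r.
have actT j g : hecke_act (T j) g = pb j g.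
  have <- : Tw [:: j] = T j by rewrite /Tword big_seq1.
  exact: hecke_act_Tword.
have act_f0 b : hecke_act b (0 : P) = 0.
  move: b; apply: FA_ind => [|u].
    split; first exact: hecke_act0.
    by move=> c x y hx hy; rewrite hecke_act_lin hx hy scaler0 addr0.
  rewrite hecke_act_Tword -[pibar_word u]/(act pb u) -(scale0r 0).
  by rewrite (act_linZ (hm_braid (dbar_hecke F n))) !scale0r.
have act2 j k g : hecke_act (T j * T k) g = pb j (pb k g).
  apply: (etrans (hecke_actM (T j) (T k) g)).
  by apply: (etrans (actT j _)); apply: (congr1 (pb j) (actT k g)).
have act3 j k l g : hecke_act (T j * T k * T l) g = pb j (pb k (pb l g)).
  apply: (etrans (hecke_actM (T j * T k) (T l) g)).
  by apply: (etrans (act2 j k _)); apply: (congr1 (fun p => pb j (pb k p)) (actT l g)).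
have rel x g : hecke_rel x -> hecke_act x g = 0.
  case=> [[j ->]|[j [k [jk ->]]]|[j [k [jk ->]]]].
  - apply: (etrans (actD _ _ g)).
    exact: etrans (congr2 (fun p q => p + q) (act2 j j g) (actT j g)) (dbar_quad j g).
  - apply: (etrans (actB _ _ g)).
    apply: (etrans (congr2 (fun p q => p - q) (act3 j k j g) (act3 k j k g))).
    by rewrite (dbar_braid g jk) subrr.
  apply: (etrans (actB _ _ g)).
  apply: (etrans (congr2 (fun p q => p - q) (act2 j k g) (act2 k j g))).
  by rewrite (dbar_comm g jk) subrr.
have gen x r y : hecke_rel r -> hecke_act (x * r * y) f = 0.
  move=> hr; apply: (etrans (hecke_actM (x * r) y f)).
  apply: (etrans (hecke_actM x r _)).
  exact: etrans (congr1 (hecke_act x) (rel r _ hr)) (act_f0 x).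
case=> l [hl ->]; elim: l hl => [|t l IH] hl; first by rewrite big_nil hecke_act0.
rewrite big_cons; apply: (etrans (actD _ _ f)).
rewrite (gen _ _ _ (hl t (mem_head _ _))) add0r; apply: IH => t' tl.
by apply: hl; rewrite inE tl orbT.
Qed.

End HeckeAlgebra.

(** * Bases of the 0-Hecke algebra *)

Section HeckeBasis.

Variables (F : fieldType) (n : nat).
Local Notation A := (FA F n).
Local Notation P := {mpoly F[n]}.
Local Notation hid := (@hecke_ideal F n).
Local Notation T := (@Tgen F n).
Local Notation Tw := (@Tword F n).
Local Notation lmul := (@hecke_lmul F n).
Local Notation pb := (@demazure_bar F n).
Local Notation len := (@perm_length n).
Variable rw : 'S_n -> seq 'I_n.-1.
Hypothesis hrw : forall w : 'S_n, reduced_word (rw w) w.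
Implicit Types (a b : A) (c : F) (j k : 'I_n.-1) (u : seq 'I_n.-1) (w v : 'S_n).

Let hH := lmul_hecke F n.
Let bH := hm_braid hH.
Let sH := @hecke_ideal_submod F n.
Local Notation TT w := (Tw (rw w)).

Lemma actw_lmul w a : actw lmul rw w a = TT w * a.
Proof. exact: act_lmul. Qed.

(** The exponents n, ..., 1 strictly decrease, so the permuted exponents [rho_at w] are pairwise
    distinct. *)
Definition rho : 'X_{1..n} := [multinom (n - i)%N | i < n].
Definition rho_at w : 'X_{1..n} := [multinom rho (w^-1%g i) | i < n].

Lemma rho_at_inj : injective rho_at.
Proof.
move=> w v e; apply: invg_inj; apply/permP => i; apply/ord_inj.
have /mnmP/(_ i) := e; rewrite /rho_at /rho 4!mnmE.
have hw := ltnW (ltn_ord (w^-1%g i)); have hv := ltnW (ltn_ord (v^-1%g i)).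
by move=> h; rewrite -(subKn hw) h subKn.
Qed.

Lemma rho_atE w j :
  [multinom rho_at w (sgen j i) | i < n] = rho_at (w * sgen j)%g.
Proof. by apply/mnmP => i; rewrite !mnmE invMg sgenV permM. Qed.

Lemma mnorm_rho_at w : mnorm (rho_at w) = mnorm rho.
Proof.
rewrite /mnorm [RHS](reindex_inj (@perm_inj _ w^-1%g)).
by apply: eq_bigr => i _; rewrite mnmE.
Qed.

Lemma reduced_consP j u w : reduced_word (j :: u) w ->
  [/\ reduced_word u (word_perm u), ~~ Ldes (word_perm u) j & w = (word_perm u * sgen j)%g].
Proof.
move=> /reducedP[e s]; have lu := len_word u; have ll := len_sgenL (word_perm u) j.
rewrite word_perm_cons in e; rewrite e -s /= in ll.
have [d|d] := boolP (Ldes (word_perm u) j).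
  by rewrite d in ll; lia.
rewrite (negPf d) in ll; split=> //; apply/reducedP; split=> //.
by case: ll.
Qed.

Lemma act_rho u w : reduced_word u w ->
  norm_lt (mnorm rho) ((act pb u 'X_[rho] : P) - 'X_[rho_at w]).
Proof.
have sL := norm_lt_submod F n (mnorm rho).
elim: u w => [|j u IH] w.
  move=> /reducedP[<- _] /=.
  have -> : rho_at 1%g = rho by apply/mnmP => i; rewrite !mnmE invg1 perm1.
  by move=> m _; rewrite subrr mcoeff0.
move=> /reduced_consP[ru d ->]; set v := word_perm u in ru d *.
have := dbar_norm_lt j (IH _ ru); rewrite (bm_linB (hm_braid (dbar_hecke F n))) => h.
apply: (submod_trans sL h).
(* As rho decreases, [rho_at v] drops at j exactly when j is not a left descent of v. *)
rewrite -rho_atE -[X in norm_lt X](mnorm_rho_at v); apply: dbar_lead.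
rewrite /rho !mnmE; have := d; rewrite /Ldes -leqNgt leq_eqVlt => /orP[/eqP|].
  by move=> /ord_inj /perm_inj /eqP; rewrite (negPf (lo_neq_hi j)).
by have := ltn_ord (v^-1%g (hi j)); lia.
Qed.

Lemma hecke_act_sum (I : finType) (Q : pred I) (c : I -> F) (f : I -> A) (p : P) :
  hecke_act (\sum_(i | Q i) c i *: f i) p = \sum_(i | Q i) c i *: hecke_act (f i) p.
Proof.
exact: (lin_sum (f := fun a => hecke_act a p) (fun d a b => hecke_act_lin d a b p)).
Qed.

(** All the x^{v rho} have the same norm, so terms of smaller norm cannot contribute to their
    coefficients: that of x^{v rho} in T_w x^rho is 1 if w = v and 0 otherwise. *)
Lemma Tword_free (c : 'S_n -> F) : hid (\sum_w c w *: TT w) -> forall w, c w = 0.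
Proof.
move=> h v; have := hecke_act_hid 'X_[rho] h; rewrite hecke_act_sum => e.
have cf w : mcoeff (rho_at v) (hecke_act (TT w) ('X_[rho] : P)) = (w == v)%:R.
  rewrite hecke_act_Tword.
  have := act_rho (hrw w) (m := rho_at v); rewrite mnorm_rho_at leqnn => /(_ isT).
  rewrite mcoeffB mcoeffX (inj_eq rho_at_inj) => /eqP; rewrite subr_eq0 => /eqP <-.
  by [].
have := congr1 (mcoeff (rho_at v)) e; rewrite mcoeff0 (raddf_sum (mcoeff (rho_at v))).
rewrite (bigD1 v) //= big1 ?addr0 => [|w /negPf nw]; last by rewrite mcoeffZ cf nw mulr0.
by rewrite mcoeffZ cf eqxx mulr1.
Qed.

Lemma Tword_mulT w k : hid (TT w * T k -
  (if (w (hi k) < w (lo k))%N then - TT w else TT (sgen k * w)%g)).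
Proof.
have e1 : actw lmul rw w (lmul k 1) = TT w * T k.
  by rewrite actw_lmul /hecke_lmul mulr1.
have e2 v : actw lmul rw v 1 = TT v by rewrite actw_lmul mulr1.
case: ifPn => d.
  by have := actw_down hH hrw 1 d; rewrite e1 e2.
by have := actw_up bH hrw 1 d; rewrite e1 e2.
Qed.

Local Notation longer w := (qspan hid (fun v => (len w < len v)%N) (fun v => TT v)).

(** T_v T_k is -T_v or T of a longer element, so right multiplication never shortens. *)
Lemma longer_right w k a : longer w a -> longer w (a * T k).
Proof.
have sL := qspan_submod sH (fun v => (len w < len v)%N) (fun v => TT v).
case=> c hc; apply: (qspan_eq sH (y := (\sum_(v | (len w < len v)%N) c v *: TT v) * T k)).
  by rewrite -mulrBl; apply: hecke_ideal_mulr.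
rewrite mulr_suml; apply: (submod_sum sL) => v lv.
rewrite -scalerAl; apply: (submodZ sL); apply: (qspan_eq sH (Tword_mulT v k)).
case: ifPn => d; first by apply: (submodN sL); apply: (qspan_base sH).
by apply: (qspan_base sH); rewrite len_sgen (negPf d); apply: leqW.
Qed.

Lemma T'word_rcons u k : T'word F (rcons u k) = T'word F u * (T k + 1).
Proof. by rewrite /T'word big_rcons. Qed.

(** Expand the product of the T_k + 1. Choosing 1 throughout gives T_w; the first T_k chosen
    lengthens w, since k is not a descent, and later factors keep it longer. *)
Lemma Tword_mulT'word w u : all (fun k : 'I_n.-1 => ~~ (w (hi k) < w (lo k))%N) u ->
  longer w (TT w * T'word F u - TT w).
Proof.
have sL := qspan_submod sH (fun v => (len w < len v)%N) (fun v => TT v).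
elim/last_ind: u => [|u k IH].
  by rewrite /T'word big_nil mulr1 subrr; case: sL.
rewrite all_rcons => /andP[d /IH {}IH]; rewrite T'word_rcons mulrA.
set X := TT w * T'word F u in IH *.
have -> : X * (T k + 1) - TT w = (X - TT w) * T k + (X - TT w) + TT w * T k.
  by rewrite mulrDr mulr1 mulrBl [RHS]addrAC subrK addrA.
apply: (submodD sL); last first.
  apply: (qspan_eq sH (Tword_mulT w k)); rewrite (negPf d).
  by apply: (qspan_base sH); rewrite len_sgen (negPf d).
by apply: (submodD sL) => //; apply: longer_right.
Qed.

Definition T'w0c (D : {set 'I_n.-1}) : A := T'word F (rw (w0_of (~: D))).
Definition hecke_elt w : A := TT w * T'w0c (descents w).

(** Since k is a left descent of w0(D^c), that element has a reduced word starting with k. Hence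
    T'_{w0(D^c)} has T'_k as its first factor, and T_k T'_k = T_k T_k + T_k vanishes. *)
Lemma T_T'w0c (D : {set 'I_n.-1}) k : k \notin D -> hid (lmul k (T'w0c D)).
Proof.
move=> kD; pose w := w0_of (~: D).
have d : Ldes w k by apply: Ldes_w0; rewrite inE.
have r : reduced_word (k :: rw (w * sgen k)%g) w.
  rewrite -[X in reduced_word _ X](mulgK (sgen k)) sgenV.
  by apply: cons_reduced (hrw _); rewrite Ldes_sgen d.
have := act_reduced (lmul'_braid F n) hrw 1 (hrw w) r.
rewrite !act_lmul' !mulr1 -/(T'w0c D) => h.
apply: (submod_eq_in sH (bm_eq bH k h)).
rewrite /T'word big_cons /hecke_lmul mulrA; apply: hecke_ideal_mulr.
by rewrite mulrDr mulr1; apply: hecke_ideal_quad.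
Qed.

Lemma T'w0c_letters w : all (fun k : 'I_n.-1 => ~~ (w (hi k) < w (lo k))%N)
  (rw (w0_of (~: descents w))).
Proof.
have [g _] := w0_ofP (~: descents w).
apply/allP => k /(allP (par_letters g (hrw _))).
by rewrite inE in_descents.
Qed.

Lemma Tword_in_span w : qspan hid predT hecke_elt (TT w).
Proof.
have sQ := qspan_submod sH predT hecke_elt.
move: {2}(n * n - len w)%N (leqnn (n * n - len w)%N) => d.
elim: d w => [|d IHd] w le.
all: apply: (submod_eq_in sQ (submod_sym sQ (y := TT w) (x := hecke_elt w) _));
  last exact: (qspan_base sH).
all: apply: (qspan_trans sH _ (Tword_mulT'word (T'w0c_letters w))) => v lv.
  by have := len_le v; lia.
by apply: IHd; have := len_le v; lia.
Qed.

Lemma Tword_span a : qspan hid predT (fun w => TT w) a.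
Proof.
have sQ := qspan_submod sH predT (fun w => TT w).
have base := @qspan_base _ _ _ sH _ predT (fun w => TT w).
move: a; apply: (FA_ind sQ) => u; elim: u => [|j u IH].
  have /reducedP[_] := hrw 1%g; rewrite len1 => /size0nil e.
  have -> : Tw [::] = TT 1%g by rewrite e.
  exact: (base 1%g isT).
rewrite Tword_cons; case: IH => c hc.
apply: (qspan_eq sH (bm_eq bH j hc)); rewrite (lin_sum (bm_lin bH j)).
apply: (submod_sum sQ) => w _; apply: (submodZ sQ).
have e2 v : actw lmul rw v 1 = TT v by rewrite actw_lmul mulr1.
have [d|d] := boolP (Ldes w j).
  have := actwL_down hH hrw 1 d; rewrite !e2 => h; apply: (qspan_eq sH h).
  exact: (submodN sQ (base w isT)).
have := actwL_up bH hrw 1 d; rewrite !e2 => h; apply: (qspan_eq sH h).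
exact: (base (w * sgen j)%g isT).
Qed.

Lemma hecke_elt_span a : qspan hid predT hecke_elt a.
Proof. by apply: (qspan_trans sH _ (Tword_span a)) => w _; apply: Tword_in_span. Qed.

Lemma hecke_elt_free (c : 'S_n -> F) : hid (\sum_w c w *: hecke_elt w) -> forall w, c w = 0.
Proof. exact: (spanning_free sH Tword_free (fun w => hecke_elt_span (TT w))). Qed.

End HeckeBasis.

(** * Compositions of n correspond to subsets of [n-1] *)

Section Compositions.

Implicit Types (a b s : seq nat).

Lemma scanl_sums o a :
  scanl addn o a = [seq (o + sumn (take k a))%N | k <- iota 1 (size a)].
Proof.
elim: a o => //= x a IH o; rewrite take0 addn0; congr (_ :: _).
rewrite IH (iotaDl 1 1) -map_comp; apply: eq_map => k /=.
by rewrite addnA.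
Qed.

Lemma path_scanl o a : all (fun x => 0 < x)%N a -> path ltn o (scanl addn o a).
Proof.
by elim: a o => //= x a IH o /andP[x0 /IH ->]; rewrite andbT -{1}[o]addn0 ltn_add2l.
Qed.

Lemma scanl_pairmap o s : path ltn o s ->
  scanl addn o (pairmap (fun x y => y - x)%N o s) = s.
Proof. by elim: s o => //= x s IH o /andP[ox /IH e]; rewrite subnKC ?e // ltnW. Qed.

Lemma pairmap_pos o s : path ltn o s ->
  all (fun x => 0 < x)%N (pairmap (fun x y => y - x)%N o s).
Proof. by elim: s o => //= x s IH o /andP[ox /IH ->]; rewrite subn_gt0 ox. Qed.

Lemma last_scanl o a : last o (scanl addn o a) = (o + sumn a)%N.
Proof. by elim: a o => [|x a IH] o /=; rewrite ?addn0 // IH addnA. Qed.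

Variable n : nat.
Hypothesis n0 : (0 < n)%N.

Definition psums a := [seq sumn (take k a) | k <- iota 1 (size a).-1].

Lemma scanl_psums a : is_composition n a -> scanl addn 0 a = rcons (psums a) n.
Proof.
case: a => [|x a] /andP[_ /eqP e]; first by move: n0; rewrite -e.
rewrite scanl_sums /psums [size _]/= -[(size a).+1]addn1 iotaD map_cat /= cats1.
by rewrite take_size -[(x + sumn a)%N]/(sumn (x :: a)) e addn1.
Qed.

Lemma mem_comp_descents a j : (j \in comp_descents n a) = (j.+1 \in psums a).
Proof. by rewrite inE. Qed.

Lemma sorted_rcons_lt s x v : sorted ltn (rcons s x) -> v \in s -> (v < x)%N.
Proof.
elim: s => //= y s IH p; rewrite inE => /orP[/eqP ->|vs].
  have /allP h := order_path_min ltn_trans p.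
  by apply: (h x); rewrite mem_rcons inE eqxx.
by apply: IH vs; apply: path_sorted p.
Qed.

Lemma psums_lt a v : is_composition n a -> v \in psums a -> (0 < v < n)%N.
Proof.
move=> ca va; have /andP[pa _] := ca; have p := path_scanl 0 pa.
rewrite scanl_psums // in p.
have /allP h := order_path_min ltn_trans p.
rewrite (h v) ?mem_rcons ?inE ?va ?orbT //=.
exact: sorted_rcons_lt (path_sorted p) va.
Qed.

(** A composition is recovered as the successive differences of its partial sums, and these form a
    strictly increasing list determined by its set of members. *)
Lemma comp_descents_inj a b : is_composition n a -> is_composition n b ->
  comp_descents n a = comp_descents n b -> a = b.
Proof.
move=> ca coinv_elt /setP e.
have half x y v : is_composition n x -> is_composition n y ->
    (forall j, (j \in comp_descents n x) = (j \in comp_descents n y)) ->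
    v \in psums x -> v \in psums y.
  move=> cx cy exy vx; have /andP[v0 vn] := psums_lt cx vx.
  have lt : (v.-1 < n.-1)%N by lia.
  by have := exy (Ordinal lt); rewrite !mem_comp_descents /= prednK // vx => <-.
have em : psums a =i psums b.
  by move=> v; apply/idP/idP; apply: half => // j; rewrite e.
have /andP[pa _] := ca; have /andP[pb _] := coinv_elt.
have es : scanl addn 0 a = scanl addn 0 b.
  apply: (irr_sorted_eq ltn_trans ltnn).
  - exact: path_sorted (path_scanl 0 pa).
  - exact: path_sorted (path_scanl 0 pb).
  by move=> v; rewrite !scanl_psums // !mem_rcons !inE em.
have K o l : pairmap (fun x y => y - x)%N o (scanl addn o l) = l.
  by elim: l o => //= x l IH o; rewrite IH addKn.
by rewrite -[a](K 0%N) es K.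
Qed.

Lemma comp_descents_surj (D : {set 'I_n.-1}) :
  exists2 a, is_composition n a & comp_descents n a = D.
Proof.
(* The composition is the list of gaps between 0, the sorted elements of D (shifted to be 1-based),
   and n. *)
pose L := [seq v <- iota 1 n.-1 | [exists j in D, j.+1 == v]].
have pL : path ltn 0 (rcons L n).
  have sL : sorted ltn L by apply: sorted_filter (iota_ltn_sorted _ _); apply: ltn_trans.
  have aL : all (fun v => 0 < v < n)%N L.
    by apply/allP => v; rewrite mem_filter mem_iota => /andP[_]; lia.
  rewrite -cats1 cat_path /= andbT; apply/andP; split.
    rewrite path_min_sorted //; apply/allP => v /(allP aL) /andP[]//.
  have := mem_last 0 L; rewrite inE => /orP[/eqP ->|/(allP aL) /andP[]] //.
pose a := pairmap (fun x y => y - x)%N 0 (rcons L n).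
have ea := scanl_pairmap pL.
have ca : is_composition n a.
  rewrite /is_composition pairmap_pos //=; apply/eqP.
  by have := last_scanl 0 a; rewrite ea last_rcons.
exists a => //; apply/setP => j; rewrite mem_comp_descents.
have -> : psums a = L by move: ea; rewrite scanl_psums // => /rcons_inj[].
rewrite mem_filter mem_iota; apply/andP/idP => [[/existsP[k /andP[kD /eqP [e]]] _]|jD].
  by rewrite -(ord_inj e).
split; first by apply/existsP; exists j; rewrite jD eqxx.
by have := ltn_ord j; lia.
Qed.

End Compositions.

Lemma uniq_map_inj (S U : eqType) (f : S -> U) (l : seq S) s t :
  uniq (map f l) -> s \in l -> t \in l -> f s = f t -> s = t.
Proof.
move=> ul sl tl e; rewrite -(nth_index s sl) -(nth_index s tl); congr nth.
apply/eqP; rewrite -(nth_uniq (f s) _ _ ul) ?size_map ?index_mem //.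
by rewrite !(nth_map s) ?index_mem // !nth_index // e.
Qed.

(** * The summands, their isomorphisms with P_alpha, and the direct sum *)

Section Decomposition.

Variables (F : fieldType) (n : nat).
Local Notation A := (FA F n).
Local Notation P := (Defs.Poly F n).
Local Notation hid := (@hecke_ideal F n).
Local Notation W := (@coinv_ideal F n).
Local Notation Tw := (@Tword F n).
Local Notation lmul := (@hecke_lmul F n).
Local Notation pb := (@demazure_bar F n).
Variable rw : 'S_n -> seq 'I_n.-1.
Hypothesis hrw : forall w : 'S_n, reduced_word (rw w) w.
Local Notation coinv_elt := (coinv_elt F rw).
Local Notation hecke_elt := (hecke_elt F rw).
Implicit Types (w v : 'S_n) (j k : 'I_n.-1) (D : {set 'I_n.-1}) (al : seq nat).

Let sW := coinv_submod F n.
Let hW := coinv_hecke F n.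
Let hH := lmul_hecke F n.
Let bH := hm_braid hH.
Let sH := @hecke_ideal_submod F n.
Let hP := dbar_hecke F n.
Let bP := hm_braid hP.
Local Notation inD D := (fun w => descents w == D).
Local Notation cD al := (comp_descents n al).

Lemma qbasis_coinv_elt : qbasis W (fun _ => True) predT coinv_elt.
Proof.
split=> // [c hc i _|x _]; first exact: (coinv_elt_free hrw hc).
exact: coinv_elt_span.
Qed.

Lemma qbasis_hecke_elt : qbasis hid (fun _ => True) predT hecke_elt.
Proof.
split=> // [c hc i _|x _]; first exact: (hecke_elt_free hrw hc).
exact: hecke_elt_span.
Qed.

(** Restricts freeness to one descent class, where x_{D(w)} and e_{D(w)} may be written with the
    fixed set D. *)
Lemma free_sub (V : lmodType F) (U : V -> Prop) (b b' : 'S_n -> V) D :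
  (forall c : 'S_n -> F, U (\sum_w c w *: b w) -> forall w, c w = 0) ->
  (forall w, descents w = D -> b' w = b w) ->
  forall c : 'S_n -> F, U (\sum_(w | descents w == D) c w *: b' w) ->
  forall w, descents w == D -> c w = 0.
Proof.
move=> fb eb c hc w wD.
have := fb (fun w => if descents w == D then c w else 0) _ w; rewrite wD; apply.
rewrite (eq_bigr (fun w => if descents w == D then c w *: b' w else 0)).
  by rewrite -big_mkcond.
by move=> v _; case: eqP => [/eb ->|_] //; rewrite scale0r.
Qed.

Lemma absorb_word D w : descents w = D ->
  all (fun j : 'I_n.-1 => w (hi j) < w (lo j))%N (rw (w0_of D)).
Proof.
move=> wD; have [g _] := w0_ofP D.
by apply/allP => k /(allP (par_letters g (hrw _))); rewrite -wD in_descents.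
Qed.

Lemma sign_sq m : (-1) ^+ m * (-1) ^+ m = 1 :> F.
Proof. by rewrite -exprD addnn -signr_odd odd_double expr0. Qed.

Lemma summand_submod al : submod (coinv_summand (F := F) rw al).
Proof.
split; first by exists 0; rewrite hecke_act0 subr0; case: sW.
move=> c x y [a ha] [b hb]; exists (c *: a + b); rewrite hecke_act_lin.
by apply: (submod_eqD sW) => //; apply: (submod_eqZ sW).
Qed.

Lemma summand_W al p : W p -> coinv_summand rw al p.
Proof. by move=> hp; exists 0; rewrite hecke_act0 subr0. Qed.

Lemma summand_coinv_elt al w : descents w = cD al ->
  coinv_summand rw al (pibar_word (rw w) (xD F (cD al))).
Proof.
(* The sign undoes the one produced by T_w T_{w0(D)} = ± T_w; the added 0 only gives the witness the
   form of [hecke_act_lin]. *)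
move=> wD; exists ((-1) ^+ size (rw (w0_of (cD al))) *: Tw (rw w) + 0).
rewrite hecke_act_lin hecke_act0 addr0 hecke_act_Tword.
have := actw_absorb hP hrw (xD F (cD al)) (absorb_word wD).
move=> /eqP; rewrite subr_eq0 => /eqP.
rewrite -[actw _ _ _ _]/(pibar_word (rw w) (summand_gen F rw al)) => ->.
by rewrite scalerA sign_sq scale1r subrr; case: sW.
Qed.

Lemma qbasis_summand al : qbasis W (coinv_summand rw al) (inD (cD al))
  (fun w => pibar_word (rw w) (xD F (cD al))).
Proof.
split=> [w /eqP|c hc w wD|x [a ha]]; first exact: summand_coinv_elt.
  apply: (free_sub (U := W) (b := coinv_elt) (D := cD al) _ _ hc wD).
    exact: (coinv_elt_free hrw).
  by move=> v e; rewrite -e.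
pose b w := actw pb rw w (xD F (cD al)).
have sQ := qspan_submod sW (inD (cD al)) b.
apply: (qspan_eq sW ha); move: a {ha}.
apply: (FA_ind (Z := fun a => qspan W (inD (cD al)) b (hecke_act a _))) => [|u].
  split; first by rewrite hecke_act0; case: sQ.
  by move=> c a1 a2 h1 h2; rewrite hecke_act_lin; apply: (submodDZ sQ).
rewrite hecke_act_Tword; apply: (act_span hW hrw).
  by move=> k kD; rewrite dbar_xD //; case: sW.
by apply: (qspan_base sW) => /=; rewrite descents_w0.
Qed.

Lemma proj_submod al : submod (proj_indec (F := F) rw al).
Proof.
split; first by exists 0; rewrite mul0r subr0; case: sH.
move=> c x y [a ha] [b hb]; exists (c *: a + b); rewrite mulrDl -scalerAl.
exact: (submod_eqD sH (submod_eqZ sH c ha) hb).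
Qed.

Lemma qbasis_proj al : qbasis hid (proj_indec rw al) (inD (cD al))
  (fun w => Tw (rw w) * T'w0c F rw (cD al)).
Proof.
split=> [w /eqP wD|c hc w wD|x [a ha]].
- exists ((-1) ^+ size (rw (w0_of (cD al))) *: Tw (rw w)).
  have := actw_absorb hH hrw (T'w0c F rw (cD al)) (absorb_word wD).
  rewrite !actw_lmul act_lmul => h; rewrite -scalerAl.
  apply: (submod_sym sH); apply: (submod_trans sH (submod_eqZ sH _ h)).
  by rewrite scalerA sign_sq scale1r subrr; case: sH.
- apply: (free_sub (U := hid) (b := hecke_elt) (D := cD al) _ _ hc wD).
    exact: (hecke_elt_free hrw).
  by move=> v e; rewrite -e.
pose b w := actw lmul rw w (T'w0c F rw (cD al)).
have sQ := qspan_submod sH (inD (cD al)) b.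
suff h : qspan hid (inD (cD al)) b x.
  by case: h => c hc; exists c; rewrite -(eq_bigr _ (fun w _ => congr1 _ (actw_lmul rw w _))).
apply: (qspan_eq sH ha); move: a {ha}.
apply: (FA_ind (Z := fun a => qspan hid (inD (cD al)) b (a * _))) => [|u].
  split; first by rewrite mul0r; case: sQ.
  move=> c a1 a2 h1 h2; rewrite (mulrDl (c *: a1) a2) -(scalerAl c a1).
  exact: (submodDZ sQ c h1 h2).
rewrite -act_lmul; apply: (act_span hH hrw); first exact: T_T'w0c.
rewrite /proj_idem -(actw_lmul rw).
by apply: (qspan_base sH) => /=; rewrite descents_w0.
Qed.

Lemma summand_qiso al : qiso W (coinv_summand rw al) pb hid (proj_indec rw al) lmul.
Proof.
apply: (basis_qiso sW sH (@dbar_lin F n) (bm_lin bH) (@coinv_dbar F n)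
  (qbasis_summand al) (qbasis_proj al)).
- exact: summand_submod.
- exact: summand_W.
- exact: proj_submod.
move=> j w /eqP wD; exists (act_coeff F (cD al) j w); split.
  apply: (act_actw hW hrw _ j wD) => k kD.
  by rewrite dbar_xD //; case: sW.
have := act_actw hH hrw (@T_T'w0c F n rw hrw (cD al)) j wD.
by rewrite actw_lmul (eq_bigr _ (fun v _ => congr1 _ (actw_lmul rw v _))).
Qed.

Lemma regular_qiso : qiso W (fun _ => True) pb hid (fun _ => True) lmul.
Proof.
apply: (basis_qiso sW sH (@dbar_lin F n) (bm_lin bH) (@coinv_dbar F n)
  qbasis_coinv_elt qbasis_hecke_elt) => //.
move=> j w _; exists (fun w' => if descents w' == descents w
  then act_coeff F (descents w) j w w' else 0); split.
  by rewrite (dbar_coinv_elt F hrw) subrr; case: sW.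
have := act_actw hH hrw (@T_T'w0c F n rw hrw (descents w)) j (erefl (descents w)).
rewrite actw_lmul big_mkcond => h.
rewrite (eq_bigr (fun v => if descents v == descents w then
  act_coeff F (descents w) j w v *: actw lmul rw v (T'w0c F rw (descents w)) else 0)) //.
move=> v _; case: eqP => [e|_]; last by rewrite scale0r.
by rewrite actw_lmul /hecke_elt e.
Qed.

Hypothesis n0 : (0 < n)%N.

Lemma coinv_direct_sum : qdirect_sum W (@is_composition n) (coinv_summand rw).
Proof.
split=> [x|l ul hl Wl t tl].
  have [c hc] := coinv_elt_span hrw x.
  have /fin_all_exists[al hal] : forall D, exists a, is_composition n a /\ cD a = D.
    by move=> D; have [a] := comp_descents_surj n0 D; exists a.
  pose p D := \sum_(w | descents w == D) c w *: coinv_elt w.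
  exists [seq (al D, p D) | D <- index_enum {set 'I_n.-1}]; split=> [t|].
    case/mapP => D _ -> /=; have [h1 h2] := hal D; split=> //.
    apply: (submod_sum (summand_submod _)) => w /eqP wD.
    apply: (submodZ (summand_submod _)).
    by have := @summand_coinv_elt (al D) w; rewrite h2 /coinv_elt wD; apply.
  rewrite big_map /=; have <- : \sum_w c w *: coinv_elt w = \sum_D p D.
    by rewrite (partition_big (@descents n) predT).
  exact: hc.
(* The pairs do not form a finite type, so coefficients are chosen for all of them, with 0 outside
   [l]. *)
have /(_ _)/constructive_indefinite_description ex : forall s : seq nat * P, exists c : 'S_n -> F,
    s \in l -> W (s.2 - \sum_(w | descents w == cD s.1) c w *: coinv_elt w).
  move=> s; have [sl|ns] := boolP (s \in l); last by exists (fun => 0).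
  have [_ hs] := hl s sl; have [_ _ /(_ _ hs)[c hc]] := qbasis_summand s.1.
  exists c => _; congr (W (_ - _)): hc; apply: eq_bigr => w /eqP e.
  by rewrite /coinv_elt e.
pose c s := sval (ex s).
have hc s : s \in l -> W (s.2 - \sum_(w | descents w == cD s.1) c s w *: coinv_elt w).
  exact: (svalP (ex s)).
(* The expansions of all members of [l] are merged into a single relation between the basis
   elements. *)
have Wsum : W (\sum_w (\sum_(s <- l | descents w == cD s.1) c s w) *: coinv_elt w).
  have -> : \sum_w (\sum_(s <- l | descents w == cD s.1) c s w) *: coinv_elt w =
    \sum_(s <- l) \sum_(w | descents w == cD s.1) c s w *: coinv_elt w.
    by under eq_bigr do rewrite scaler_suml; rewrite (exchange_big_dep predT).
  apply: (submod_eq_in sW (submod_sym sW _) Wl).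
  rewrite [X in X - _]big_seq [X in _ - X]big_seq.
  by apply: (submod_eq_sum sW).
apply: (submod_eq_in sW (hc t tl)).
rewrite big1 => [|w /eqP wt]; first by case: sW.
have [ct _] := hl t tl.
(* A descent set determines its composition and the compositions in [l] are distinct, so only [t]
   contributes to the coefficient of w. *)
have := coinv_elt_free hrw Wsum w; rewrite big_mkcond (bigD1_seq t) ?(map_uniq ul) //=.
rewrite wt eqxx big1_seq ?addr0 => [->|s /andP[st sl]]; first by rewrite scale0r.
case: eqP => // /(comp_descents_inj n0 ct (proj1 (hl s sl))) e.
by case/eqP: st; apply: (uniq_map_inj ul sl tl (esym e)).
Qed.

End Decomposition.

Theorem theorem4p5 (F : fieldType) (n : nat) (hn : (0 < n)%N)
    (rw : 'S_n -> seq 'I_n.-1) (hrw : forall w : 'S_n, reduced_word (rw w) w) :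
  [/\
    (* basis {pibar_w x_{D(w)} : w in S_n} of the coinvariant algebra *)
    qbasis (@coinv_ideal F n) (fun _ => True) (fun _ : 'S_n => true)
      (fun w => pibar_word (rw w) (xD F (descents w))),
    (* direct sum decomposition over the compositions alpha of n *)
    qdirect_sum (@coinv_ideal F n) (@is_composition n) (coinv_summand rw),
    (* each summand: basis {pibar_w x_{D(alpha)} : D(w) = D(alpha)}, and ~= P_alpha *)
    (forall alpha : seq nat, is_composition n alpha ->
       qbasis (@coinv_ideal F n) (coinv_summand rw alpha)
         (fun w : 'S_n => descents w == comp_descents n alpha)
         (fun w => pibar_word (rw w) (xD F (comp_descents n alpha)))
       /\ qiso (@coinv_ideal F n) (coinv_summand rw alpha) (@demazure_bar F n)
               (@hecke_ideal F n) (proj_indec rw alpha) (@hecke_lmul F n))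
  & (* isomorphic to the regular representation of H_n(0) *)
    qiso (@coinv_ideal F n) (fun _ => True) (@demazure_bar F n)
         (@hecke_ideal F n) (fun _ => True) (@hecke_lmul F n)].
Proof.
split.
- exact: qbasis_coinv_elt.
- exact: coinv_direct_sum.
- by move=> al _; split; [apply: qbasis_summand | apply: summand_qiso].
exact: regular_qiso.
Qed.
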